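(* Let $G$ be a finite simple graph that contains none of $P_2+P_3$, $\overline{P_2+P_3}$, $K_2+K_3$, co-banner, $\overline{H_2}$ as an induced subgraph, and suppose $G$ contains an induced $\overline{H_3}$. Then the complement graph $\overline{G}$ is a good graph.
   Context: $P_2+P_3$ is the disjoint union of a two-vertex path and a three-vertex path, $\overline{P_2+P_3}$ its complement; $K_2+K_3$ is the disjoint union of an edge and a triangle. A banner is a chordless 4-cycle plus one vertex adjacent to exactly one vertex of the cycle; a co-banner is its complement. $\overline{H_2}$ is the graph with vertices $v_1,v_2,v_3,v_4,b_1,b_2$ and edges $v_1v_2,v_2v_3,v_3v_4,v_4v_1,b_1v_1,b_1v_2,b_2v_2,b_2v_3,b_1b_2$ and no others. $H_3$ is the graph with vertices $v_1,v_2,v_3,v_4,b_1,b_2$ and edges $v_1v_2,v_2v_3,v_3v_4,v_4v_1,b_1v_1,b_1v_2,b_2v_2,b_2v_3$ and no others, and $\overline{H_3}$ is its complement (equivalently: a chordless 4-cycle $w_1w_2w_3w_4$, a vertex $b$ adjacent exactly to $w_1,w_2$, and a vertex $t$ adjacent only to $b$). $\chi$, $\omega$ denote chromatic and clique number, $N(v)$ the neighbourhood and $d(v)=|N(v)|$. Two vertices are comparable if they are nonadjacent and the neighbourhood of one is contained in that of the other. A universal vertex is adjacent to all other vertices. A vertex $v$ of a graph $F$ is nice if $d(v)\leq\omega(F)+2$. $F$ is nice if it has three pairwise disjoint stable sets $S_1,S_2,S_3$ with $\omega(F-(S_1\cup S_2\cup S_3))\leq\omega(F)-2$. $F$ is good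 if at least one holds: (a) $F$ has a pair of comparable vertices; (b) $F$ has a universal vertex; (c) $F$ has a nice vertex; (d) $F$ is nice; (e) $\chi(F)\leq\omega(F)+3$. *)

(* Defs.v *)
From mathcomp Require Import all_boot.

Set Implicit Arguments.
Unset Strict Implicit.
Unset Printing Implicit Defensive.

Record sgraph := SGraph {
  vertex :> finType;
  adj : rel vertex;
  adj_sym : symmetric adj;
  adj_irr : irreflexive adj }.

Arguments adj {s} : rename.

Definition compl_adj (G : sgraph) : rel G := fun x y => (x != y) && ~~ adj x y.

Lemma compl_adj_sym (G : sgraph) : symmetric (@compl_adj G).
Proof. by move=> x y; rewrite /compl_adj eq_sym adj_sym. Qed.

Lemma compl_adj_irr (G : sgraph) : irreflexive (@compl_adj G).
Proof. by move=> x; rewrite /compl_adj eqxx. Qed.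

Definition compl (G : sgraph) : sgraph :=
  SGraph (@compl_adj_sym G) (@compl_adj_irr G).

Definition union_adj (G H : sgraph) : rel (G + H)%type := fun x y =>
  match x, y with
  | inl a, inl b => adj a b
  | inr a, inr b => adj a b
  | _, _ => false
  end.

Lemma union_adj_sym (G H : sgraph) : symmetric (@union_adj G H).
Proof. by move=> [x|x] [y|y] //=; rewrite adj_sym. Qed.

Lemma union_adj_irr (G H : sgraph) : irreflexive (@union_adj G H).
Proof. by move=> [x|x] /=; rewrite adj_irr. Qed.

Definition disjoint_union (G H : sgraph) : sgraph :=
  SGraph (@union_adj_sym G H) (@union_adj_irr G H).

Definition induced_adj (G : sgraph) (A : {set G}) : rel {x : G | x \in A} :=
  fun x y => adj (val x) (val y).

Lemma induced_adj_sym (G : sgraph) (A : {set G}) : symmetric (@induced_adj G A).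
Proof. by move=> x y; rewrite /induced_adj adj_sym. Qed.

Lemma induced_adj_irr (G : sgraph) (A : {set G}) :
  irreflexive (@induced_adj G A).
Proof. by move=> x; rewrite /induced_adj adj_irr. Qed.

Definition induced (G : sgraph) (A : {set G}) : sgraph :=
  SGraph (@induced_adj_sym G A) (@induced_adj_irr G A).

Definition del_vertices (G : sgraph) (A : {set G}) : sgraph := induced (~: A).

Definition edges_adj (n : nat) (E : seq (nat * nat)) : rel 'I_n := fun i j =>
  (i != j) && (((i : nat, j : nat) \in E) || ((j : nat, i : nat) \in E)).

Lemma edges_adj_sym n E : symmetric (@edges_adj n E).
Proof. by move=> i j; rewrite /edges_adj eq_sym orbC. Qed.

Lemma edges_adj_irr n E : irreflexive (@edges_adj n E).
Proof. by move=> i; rewrite /edges_adj eqxx. Qed.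

Definition graph_of_edges (n : nat) (E : seq (nat * nat)) : sgraph :=
  SGraph (@edges_adj_sym n E) (@edges_adj_irr n E).

Definition path_graph (n : nat) : sgraph :=
  graph_of_edges n [seq (i, i.+1) | i <- iota 0 n.-1].

Definition complete_graph (n : nat) : sgraph :=
  graph_of_edges n [seq (i, j) | i <- iota 0 n, j <- iota 0 n].

Definition P2_P3 : sgraph := disjoint_union (path_graph 2) (path_graph 3).
Definition K2_K3 : sgraph :=
  disjoint_union (complete_graph 2) (complete_graph 3).

Definition banner : sgraph :=
  graph_of_edges 5 [:: (0, 1); (1, 2); (2, 3); (3, 0); (4, 0)].
Definition co_banner : sgraph := compl banner.

(* In the next two graphs v1, v2, v3, v4, b1, b2 are 0, 1, 2, 3, 4, 5. *)
Definition co_H2 : sgraph :=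
  graph_of_edges 6 [:: (0, 1); (1, 2); (2, 3); (3, 0);
                       (4, 0); (4, 1); (5, 1); (5, 2); (4, 5)].
Definition H3 : sgraph :=
  graph_of_edges 6 [:: (0, 1); (1, 2); (2, 3); (3, 0);
                       (4, 0); (4, 1); (5, 1); (5, 2)].
Definition co_H3 : sgraph := compl H3.

Definition contains_induced (G H : sgraph) : Prop :=
  exists f : H -> G, injective f /\ forall x y, adj (f x) (f y) = adj x y.

Definition neighbours (G : sgraph) (v : G) : {set G} := [set w | adj v w].

Definition degree (G : sgraph) (v : G) : nat := #|neighbours v|.

Definition clique (G : sgraph) (A : {set G}) : bool :=
  [forall x in A, forall y in A, (x != y) ==> adj x y].

Definition stable (G : sgraph) (A : {set G}) : bool :=
  [forall x in A, forall y in A, ~~ adj x y].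

Definition omega (G : sgraph) : nat := \max_(A : {set G} | clique A) #|A|.

Definition colorable (G : sgraph) (k : nat) : bool :=
  [exists c : {ffun G -> 'I_k},
     [forall x, forall y, adj x y ==> (c x != c y)]].

Lemma colorable_card (G : sgraph) : exists k, colorable G k.
Proof.
exists #|G|; apply/existsP; exists [ffun x => enum_rank x].
apply/forallP=> x; apply/forallP=> y; apply/implyP=> xy; rewrite !ffunE.
by apply: contraTneq xy => /enum_rank_inj->; rewrite adj_irr.
Qed.

Definition chi (G : sgraph) : nat := ex_minn (colorable_card G).

(* Without x != y every vertex would be comparable to itself. *)
Definition comparable_vertices (G : sgraph) (x y : G) : Prop :=
  [/\ x != y, ~~ adj x y &
      neighbours x \subset neighbours y \/ neighbours y \subset neighbours x].

Definition universal_vertex (G : sgraph) (v : G) : Prop := forall w, w != v -> adj v w.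

Definition nice_vertex (G : sgraph) (v : G) : Prop := degree v <= omega G + 2.

(* The bound omega(F - S) <= omega(F) - 2 is written additively because
   subtraction on nat is truncated. *)
Definition nice_graph (F : sgraph) : Prop :=
  exists S1 S2 S3 : {set F},
    [/\ stable S1, stable S2 & stable S3] /\
    [/\ [disjoint S1 & S2], [disjoint S1 & S3] & [disjoint S2 & S3]] /\
    omega (del_vertices (S1 :|: S2 :|: S3)) + 2 <= omega F.

Definition good (F : sgraph) : Prop :=
  (exists x y : F, comparable_vertices x y) \/
  (exists v : F, universal_vertex v) \/
  (exists v : F, nice_vertex v) \/
  nice_graph F \/
  chi F <= omega F + 3.

(* Main.v *)
Require Import Defs.
From mathcomp Require Import all_boot.

(* Write v1 v2 v3 v4 for the chordless 4-cycle, b for the vertex seeing v1, v2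
   and t for the pendant vertex of an induced co-H3 of G; everything below is
   said in G, so that cliques and stable sets of compl G are exchanged.

   The forbidden subgraphs leave only twelve possible traces of a further
   vertex on these six. If every further vertex that sees v3 or v4 sees all six,
   then the vertices missing both v3 and v4 induce a disjoint union of cliques,
   and three more cliques cover the rest. Otherwise the trace {v1, v2}
   does not occur, and a vertex with an empty or a full trace yields an isolated
   vertex or a comparable pair. In the remaining case each vertex either sits in
   a cell of a 3 x 3 grid (two cells see each other when they differ in row and
   in column, and the six given vertices are among the nine cells), or belongs to
   one of six stable classes, one per row and one per column. The class vertices
   carry labels, at most one per class and label: two row classes (or two column
   classes) see each other across different labels, a row class and a column
   class see each other across equal labels.

   With three labels the full structure is the complement of the Schlaefli
   graph on 27 vertices, and a finite certificate shows that every induced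
   subgraph containing the six vertices has a clique cover of size at most its
   stability number plus 3. With at least four labels, nearly all class vertices
   lie in at most three classes, and one of the six vertices is nice. *)

Set Implicit Arguments.
Unset Strict Implicit.
Unset Printing Implicit Defensive.

(** * Reflective search for forbidden induced subgraphs *)

Definition entry (m : seq (seq bool)) i j := nth false (nth [::] m i) j.

(* [&&], [||] and [has] evaluate all their arguments under [vm_compute]; the
   searches below use explicit conditionals so as to stop early. *)
Fixpoint lazy_has T (f : T -> bool) s :=
  if s is x :: s' then if f x then true else lazy_has f s' else false.

Lemma lazy_hasE T (f : T -> bool) s : lazy_has f s = has f s.
Proof. by elim: s => //= x s ->. Qed.

(** Backtracking: [s] holds the images of the pattern vertices placed so far, [p] the rows still to
    place. A pattern row lists adjacencies to earlier vertices only, so it is compared directly with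
    [s]. *)
Fixpoint embeds (m : seq (seq bool)) (p : seq (seq bool)) (s : seq nat) :=
  if p is row :: p' then
    lazy_has (fun v =>
      if v \in s then false
      else if [seq entry m v w | w <- s] == row then embeds m p' (rcons s v)
      else false) (iota 0 (size m))
  else true.

Definition pattern (n : nat) (E : seq (nat * nat)) : seq (seq bool) :=
  [seq [seq ((i, j) \in E) || ((j, i) \in E) | j <- iota 0 i] | i <- iota 0 n].

Definition forbidden : seq (seq (seq bool)) :=
  [:: pattern 5 [:: (0, 1); (2, 3); (3, 4)];
      pattern 5 [:: (0, 1); (2, 3); (3, 4); (2, 4)];
      pattern 5 [:: (0, 2); (0, 3); (0, 4); (1, 2); (1, 3); (1, 4); (2, 4)];
      pattern 5 [:: (0, 2); (1, 3); (1, 4); (2, 4); (3, 4)];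
      pattern 6 [:: (0, 1); (1, 2); (2, 3); (3, 0);
                    (4, 0); (4, 1); (5, 1); (5, 2); (4, 5)]].

Definition bad m := lazy_has (fun p => embeds m p [::]) forbidden.

Lemma embedsP m p s : embeds m p s -> exists2 t,
  [/\ size t = size p, {subset t <= iota 0 (size m)} & uniq s -> uniq (s ++ t)] &
  forall i, i < size p ->
    [seq entry m (nth 0 t i) w | w <- s ++ take i t] = nth [::] p i.
Proof.
elim: p s => [|row p IH] s /=.
  by move=> _; exists [::] => //; split=> // us; rewrite cats0.
rewrite lazy_hasE => /hasP[v vm].
case: ifPn => // vs; case: eqP => // rowE /IH[t [szt subt unt] tE].
exists (v :: t); first split=> /=.
- by rewrite szt.
- by move=> w; rewrite inE => /predU1P[->|/subt].
- by move=> us; rewrite -cat_rcons; apply: unt; rewrite rcons_uniq vs.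
case=> [|i] /= lti; first by rewrite cats0.
by rewrite -cat_rcons; apply: tE.
Qed.

Section Graph.
Variable G : sgraph.
Implicit Type vs : seq G.

Definition amx vs := [seq [seq adj x y | y <- vs] | x <- vs].

Lemma entry_amx x0 vs i j : i < size vs -> j < size vs ->
  entry (amx vs) i j = adj (nth x0 vs i) (nth x0 vs j).
Proof. by move=> lti ltj; rewrite /entry (nth_map x0) // (nth_map x0). Qed.

Definition ext (r : seq bool) (m : seq (seq bool)) :=
  (false :: r) :: [seq b.1 :: b.2 | b <- zip r m].

Lemma amx_cons (x : G) vs : amx (x :: vs) = ext [seq adj x y | y <- vs] (amx vs).
Proof.
rewrite /amx /ext /= adj_irr; congr (_ :: _).
rewrite -[in RHS](eq_map (fun y => adj_sym y x)).
have zipE (g : G -> seq bool) s : [seq adj z x :: g z | z <- s] =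
    [seq b.1 :: b.2 | b <- zip [seq adj z x | z <- s] [seq g z | z <- s]].
  by elim: s => //= z s ->.
exact: zipE.
Qed.

Lemma contains_embeds (H : sgraph) (n : nat) (E : seq (nat * nat)) (code : H -> nat) vs :
    injective code -> (forall x : H, code x < n) ->
    (forall x y : H, code y < code x ->
       adj x y = ((code x, code y) \in E) || ((code y, code x) \in E)) ->
    uniq vs -> embeds (amx vs) (pattern n E) [::] -> contains_induced G H.
Proof.
move=> codeI coden adjE uvs /embedsP[t [szt subt /(_ isT) /= ut] tE].
rewrite size_map size_iota in szt tE.
have ltt i : i < n -> nth 0 t i < size vs.
  move=> lti; have := subt (nth 0 t i); rewrite mem_nth ?szt // => /(_ isT).
  by rewrite mem_iota size_map.
case: vs uvs subt tE ltt => [|x0 vs0] uvs subt tE ltt.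
  have f0 (x : H) : False by have := ltt _ (coden x).
  by exists (fun x => match f0 x with end); split=> x; case: (f0 x).
set vs := x0 :: vs0 in uvs subt tE ltt.
pose f x := nth x0 vs (nth 0 t (code x)); exists f.
have adjf x y : code y < code x -> adj (f x) (f y) = adj x y.
  move=> ltyx; have := tE _ (coden x).
  rewrite (nth_map 0) ?size_iota // nth_iota // add0n.
  move/(congr1 (fun s => nth false s (code y))).
  rewrite (nth_map 0) ?size_take ?szt ?coden //.
  rewrite (nth_map 0) ?size_iota // nth_iota // add0n nth_take //.
  by rewrite (entry_amx x0) ?ltt // -adjE.
split=> [x y|x y].
  move/eqP; rewrite nth_uniq ?ltt // => /eqP /eqP.
  by rewrite nth_uniq ?szt // => /eqP /codeI.
case: (ltngtP (code x) (code y)) => [lt|lt|/codeI->].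
- by rewrite adj_sym adjf // adj_sym.
- exact: adjf.
- by rewrite !adj_irr.
Qed.

Definition sum_code m n (x : 'I_m + 'I_n) : nat :=
  match x with inl i => i | inr j => m + j end.

Lemma sum_code_inj m n : injective (@sum_code m n).
Proof.
move=> [i|i] [j|j] /= eqij; last by move/addnI/val_inj: eqij => ->.
- by rewrite (val_inj eqij).
- by have := ltn_ord i; rewrite eqij ltnNge leq_addr.
- by have := ltn_ord j; rewrite -eqij ltnNge leq_addr.
Qed.

Lemma sum_code_lt m n (x : 'I_m + 'I_n) : sum_code x < m + n.
Proof. by case: x => i /=; rewrite ?ltn_add2l // ltn_addr. Qed.

Lemma amx_free vs :
    ~ contains_induced G P2_P3 -> ~ contains_induced G (compl P2_P3) ->
    ~ contains_induced G K2_K3 -> ~ contains_induced G co_banner ->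
    ~ contains_induced G co_H2 -> uniq vs -> ~~ bad (amx vs).
Proof.
move=> h1 h2 h3 h4 h5 uvs; rewrite /bad lazy_hasE; apply/hasP=> -[p].
rewrite !inE => /or4P[| | |/orP[]] /eqP-> emb.
- apply/h1/(@contains_embeds P2_P3 5 _ (@sum_code 2 3) vs _ _ _ uvs emb).
  + exact: sum_code_inj.
  + exact: sum_code_lt.
  + by do 2![case=> [[[|[|//]] ?]|[[|[|[|//]]] ?]]].
- apply/h3/(@contains_embeds K2_K3 5 _ (@sum_code 2 3) vs _ _ _ uvs emb).
  + exact: sum_code_inj.
  + exact: sum_code_lt.
  + by do 2![case=> [[[|[|//]] ?]|[[|[|[|//]]] ?]]].
- apply/h2/(@contains_embeds (compl P2_P3) 5 _ (@sum_code 2 3) vs _ _ _ uvs emb).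
  + exact: sum_code_inj.
  + exact: sum_code_lt.
  + by do 2![case=> [[[|[|//]] ?]|[[|[|[|//]]] ?]]].
- apply/h4/(@contains_embeds co_banner 5 _ (@nat_of_ord 5) vs _ _ _ uvs emb).
  + exact: ord_inj.
  + exact: ltn_ord.
  + by do 2![case=> [[|[|[|[|[|//]]]]] ?]].
- apply/h5/(@contains_embeds co_H2 6 _ (@nat_of_ord 6) vs _ _ _ uvs emb).
  + exact: ord_inj.
  + exact: ltn_ord.
  + by do 2![case=> [[|[|[|[|[|[|//]]]]]] ?]].
Qed.

End Graph.

(** * The grid model *)

(* Kind [3 * i + j < 9] is the grid cell in row i and column j, kind [9 + i] the
   class of row i and kind [12 + j] the class of column j; [same] tells whether
   two class vertices have the same label. *)
Definition madj (k l : nat) (same : bool) : bool :=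
  if k < 9 then
    if l < 9 then (k %/ 3 != l %/ 3) && (k %% 3 != l %% 3)
    else if l < 12 then k %/ 3 == l - 9 else k %% 3 == l - 12
  else if l < 9 then
    if k < 12 then l %/ 3 == k - 9 else l %% 3 == k - 12
  else if (k < 12) == (l < 12) then (k != l) && ~~ same else same.

Lemma madjC k l a : madj k l a = madj l k a.
Proof.
rewrite /madj; case: (k < 9); case: (l < 9) => //.
  by rewrite (eq_sym (k %/ 3)) (eq_sym (k %% 3)).
by rewrite (eq_sym (k < 12)) (eq_sym k).
Qed.

Lemma madj_special k l a c : k < 9 -> madj k l a = madj k l c.
Proof. by rewrite /madj => ->. Qed.

Lemma madj_diag k a : madj k k a = false.
Proof. by rewrite /madj !eqxx; case: (k < 9). Qed.

Lemma madj_class k l a : 8 < k -> 8 < l -> k != l -> madj k l a = (a == madj k l true).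
Proof.
move=> k8 l8 kl; rewrite /madj (ltnNge k 9) (ltnNge l 9) k8 l8 kl /=.
by case: ifP; case: a.
Qed.

(* The cells of v1, v2, v3, v4, b, t, in this order. *)
Definition base_kinds := [:: 8; 4; 6; 1; 0; 7].
Definition extra_kinds := [:: 2; 3; 5; 9; 10; 11; 12; 13; 14].
Definition class_kinds := [:: 9; 10; 11; 12; 13; 14].

(* Signatures list the adjacencies to v1, v2, v3, v4, b, t. *)
Definition ksig k := [seq madj k l false | l <- base_kinds].
Definition base_mx := [seq ksig k | k <- base_kinds].

Definition sig_none := nseq 6 false.
Definition sig_all := nseq 6 true.
Definition sig_v1v2 := [:: true; true; false; false; false; false].
Definition sigs := [:: sig_none, sig_v1v2, sig_all & map ksig extra_kinds].

Fixpoint bools n :=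
  if n is n'.+1 then [seq b :: s | b <- [:: true; false], s <- bools n']
  else [:: [::]].

Lemma mem_bools s : s \in bools (size s).
Proof.
elim: s => [|b s IH]; first by rewrite inE.
by apply/allpairsP; exists (b, s); split=> //; case: b.
Qed.

(* In the matrices below the rows of the new vertices come before those of the
   six base vertices. *)
Lemma type_check :
  all (fun s => if s \in sigs then true else bad (ext s base_mx)) (bools 6).
Proof. by vm_compute. Qed.

Lemma pair_check_all :
  all (fun s => if s \in [:: sig_none; sig_v1v2; ksig 10; ksig 14] then true else
         bad (ext (false :: sig_all) (ext s base_mx))) sigs.
Proof. by vm_compute. Qed.

(* The kinds outside the base that see v3 or v4. *)
Definition attached := [:: 2; 3; 5; 9; 11; 12; 13].

Lemma pair_check_v1v2 :
  all (fun k => all (fun a =>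
         bad (ext (a :: sig_v1v2) (ext (ksig k) base_mx))) [:: true; false])
    attached.
Proof. by vm_compute. Qed.

Lemma pair_check_none :
  all (fun s => if s \in [:: sig_v1v2; sig_all] then true else
         bad (ext (true :: sig_none) (ext s base_mx))) sigs.
Proof. by vm_compute. Qed.

(** Kinds 10 and 14 see a single base vertex, v2 or v1, and the boolean [k == 10] serves as its
    index. If a full-trace vertex misses such a vertex x, a further neighbour of x must see that
    base vertex, unless its own trace is empty or {v1, v2}. *)
Lemma triple_check_all :
  all (fun k => all (fun s => all (fun a =>
     if (s \in [:: sig_none; sig_v1v2]) || nth false s (k == 10) then true
     else bad (ext (true :: false :: ksig k) (ext (a :: s) (ext sig_all base_mx))))
    [:: true; false]) sigs) [:: 10; 14].
Proof. by vm_compute. Qed.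

(** Two distinct classes are exempt, since their adjacency depends on labels. All other pairs behave
    as in the model, and no cell is taken twice. *)
Lemma pair_check :
  all (fun k => all (fun l => all (fun a =>
     if (k != l) && (8 < k) && (8 < l) ||
        (a == madj k l false) && ~~ ((k == l) && (k < 9)) then true
     else bad (ext (a :: ksig k) (ext (ksig l) base_mx)))
    [:: true; false]) extra_kinds) extra_kinds.
Proof. by vm_compute. Qed.

(* Transitivity of "same label": k and l, as well as l and m, share their label,
   while k and m do not. *)
Lemma triple_check :
  all (fun k => all (fun l => all (fun m =>
     if (k == l) || (l == m) then true else
         bad (ext [:: madj k l true, madj k m false & ksig k]
              (ext (madj l m true :: ksig l) (ext (ksig m) base_mx))))
    class_kinds) class_kinds) class_kinds.
Proof. by vm_compute. Qed.

(* Class vertices of three different classes with pairwise different labels,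
   in the presence of a fourth label, are only possible in these classes: the
   cells that would exclude them may be absent from the graph. *)
Definition triads :=
  [:: [:: 9; 11; 12]; [:: 9; 11; 14]; [:: 10; 11; 14];
      [:: 10; 13; 12]; [:: 10; 13; 14]; [:: 9; 13; 12]].

Definition is_triad s := has (perm_eq s) triads.

Definition four_ok k l m n :=
  if ~~ uniq [:: k; l; m] || (n \in [:: k; l; m]) && is_triad [:: k; l; m]
  then true else
     bad (ext [:: madj k l false, madj k m false, madj k n false & ksig k]
         (ext [:: madj l m false, madj l n false & ksig l]
              (ext (madj m n false :: ksig m) (ext (ksig n) base_mx)))).

Lemma four_check :
  all (fun k => all (fun l => all (fun m => all (four_ok k l m)
    class_kinds) class_kinds) class_kinds) class_kinds.
Proof. by vm_compute. Qed.

(* The pairs completing a class c to a triad form a path on four classes. *)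
Definition link_ok a b c w w' :=
  [&& uniq [:: a; b; c], w \notin [:: a; b; c], w' \notin [:: a; b; c]
    & is_triad [:: a; b; c]] ==>
  [&& is_triad [:: w; b; c] && is_triad [:: w'; b; c] ==> (w == w'),
      is_triad [:: a; w; c] && is_triad [:: a; w'; c] ==> (w == w')
    & is_triad [:: w; b; c] && is_triad [:: a; w'; c] ==>
        (w != w') && ~~ is_triad [:: w; w'; c]].

Lemma link_check :
  all (fun a => all (fun b => all (fun c => all (fun w => all (link_ok a b c w)
    class_kinds) class_kinds) class_kinds) class_kinds) class_kinds.
Proof. by vm_compute. Qed.

(** Some base vertex sees two classes of the triad entirely, and the third class [m] is one that
    three base vertices extend to a stable set (see [omega_class3]). *)
Lemma triad_base s : is_triad s ->
  exists k m, [/\ k \in base_kinds, m \in [:: 9; 10; 12; 14]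
    & perm_eq s [:: 9 + k %/ 3; 12 + k %% 3; m]].
Proof.
have /allP h : all (fun s => has (fun k => has (fun m =>
   perm_eq s [:: 9 + k %/ 3; 12 + k %% 3; m]) [:: 9; 10; 12; 14]) base_kinds) triads by [].
case/hasP=> r /h /hasP[k kb /hasP[m mb pr] sr]; exists k, m; split=> //.
exact: perm_trans sr pr.
Qed.

(** * Induced subgraphs of the complement of the Schlaefli graph *)

(* Code p < 9 is the cell p, and code [9 + 6 * l + c] is the vertex of label l in
   the class of kind [9 + c]. *)
Definition adj27 p q :=
  madj (if p < 9 then p else 9 + (p - 9) %% 6) (if q < 9 then q else 9 + (q - 9) %% 6)
    ((p - 9) %/ 6 == (q - 9) %/ 6).

(** In terms of the 27 lines on a cubic surface these are the 45 tritangent planes. Certificates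
    name them by position in this list. *)
Definition triangles :=
  [seq s <- [seq [:: p; q.1; q.2] | p <- iota 0 27,
                  q <- [seq (q, r) | q <- iota p (27 - p), r <- iota q (27 - q)]]
    | pairwise adj27 s].

(* A decision tree over the presence of vertices. A leaf lists triangles covering
   every vertex not known to be absent; the vertices known to be present must
   contain a stable set smaller than this list by at most three. *)
Inductive certificate :=
  | Cover of seq nat
  | Branch of nat & certificate & certificate.

Fixpoint has_stable k : seq nat -> bool :=
  if k is k'.+1 then
    fix search s :=
      if s is p :: s' then
        if has_stable k' [seq q <- s' | ~~ adj27 p q] then true else search s'
      else false
  else fun=> true.

Fixpoint certifies c inn out :=
  match c with
  | Cover ts => [&& uniq inn, has_stable (size ts - 3) inn
      & all (fun p => (p \in out) || has (fun i => p \in nth [::] triangles i) ts)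
          (iota 0 27)]
  | Branch p c1 c2 => certifies c1 (p :: inn) out && certifies c2 inn (p :: out)
  end.

(* These nine triangles partition all 27 vertices. *)
Definition Full := Cover [:: 6; 0; 10; 34; 40; 35; 38; 41; 44].

(* Found by an exhaustive computer search. *)
Definition schlaefli_certificate :=
  Branch 24 (Branch 12 (Branch 18 Full (Branch 15 (Branch 16 Full (Branch 21
  (Branch 14 Full (Branch 9 Full (Cover [:: 11; 5; 1; 36; 37; 39; 42; 29])))
  (Branch 26 (Branch 17 (Branch 11 Full (Cover
  [:: 5; 12; 40; 3; 18; 26; 28; 23])) (Cover
  [:: 6; 10; 2; 18; 37; 44; 32; 40])) (Cover
  [:: 11; 5; 1; 27; 34; 35; 40; 44])))) (Branch 26 (Branch 20 (Branch 14 Full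
  (Branch 10 (Branch 11 Full (Cover [:: 0; 34; 9; 26; 10; 22; 39; 18])) (Cover
  [:: 0; 6; 10; 34; 38; 39; 42; 29]))) (Branch 17 (Branch 16 (Branch 2 Full
  (Cover [:: 0; 6; 36; 27; 17; 33; 39; 43])) (Cover
  [:: 0; 6; 12; 17; 36; 27; 39; 29])) (Cover
  [:: 0; 6; 12; 29; 17; 38; 39; 18]))) (Branch 23 (Branch 22 (Branch 19
  (Branch 13 (Branch 2 Full (Cover [:: 0; 6; 27; 17; 40; 36; 33; 44])) (Cover
  [:: 0; 15; 26; 9; 12; 28; 22; 37])) (Cover
  [:: 6; 0; 27; 40; 36; 12; 17; 33])) (Cover
  [:: 0; 6; 10; 27; 33; 36; 40; 44])) (Cover
  [:: 0; 15; 27; 9; 11; 22; 34; 44]))))) (Branch 26 (Branch 20 (Branch 14 Full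
  (Branch 10 (Branch 11 Full (Branch 9 Full (Cover
  [:: 0; 6; 13; 29; 17; 36; 41; 19]))) (Branch 11 (Branch 9 (Branch 3 Full
  (Cover [:: 6; 0; 38; 29; 13; 34; 41; 44])) (Cover
  [:: 0; 6; 13; 17; 38; 41; 28; 29])) (Cover
  [:: 0; 6; 16; 29; 14; 34; 42; 8])))) (Branch 25 (Branch 17 (Branch 11 Full
  (Branch 16 (Branch 15 Full (Cover [:: 6; 10; 0; 33; 36; 41; 44; 20])) (Cover
  [:: 6; 36; 20; 32; 10; 3; 44; 7]))) (Branch 10 (Branch 9 (Branch 19 Full
  (Cover [:: 0; 10; 7; 35; 38; 43; 23; 26])) (Cover
  [:: 0; 37; 9; 26; 10; 21; 41; 19])) (Cover
  [:: 0; 10; 6; 33; 41; 37; 44; 9]))) (Cover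
  [:: 6; 27; 0; 34; 14; 16; 35; 44]))) (Branch 19 (Branch 18 (Branch 9 (Branch
  10 Full (Branch 21 (Branch 5 Full (Cover [:: 5; 11; 3; 29; 42; 38; 34; 44]))
  (Cover [:: 11; 5; 1; 33; 37; 42; 43; 28]))) (Branch 23 (Branch 22 (Branch 13
  (Branch 2 Full (Cover [:: 0; 6; 28; 17; 43; 38; 35; 42])) (Cover
  [:: 6; 0; 28; 38; 13; 43; 17; 35])) (Cover
  [:: 0; 6; 10; 35; 38; 42; 43; 28])) (Cover
  [:: 0; 16; 28; 9; 11; 21; 37; 42]))) (Branch 25 (Branch 13 (Branch 3 Full
  (Cover [:: 18; 22; 8; 4; 30; 34; 29; 11])) (Branch 10 (Cover
  [:: 8; 0; 12; 24; 29; 22; 17; 36]) (Branch 3 (Cover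
  [:: 0; 10; 6; 34; 38; 44; 13; 29]) (Cover [:: 0; 6; 34; 29; 13; 38; 44]))))
  (Branch 22 (Branch 21 (Cover [:: 7; 0; 10; 36; 26; 22; 37; 44]) (Branch 20
  (Cover [:: 6; 10; 0; 37; 42; 33; 21; 28]) (Branch 16 (Cover
  [:: 6; 10; 19; 30; 34; 3; 18; 26]) (Cover [:: 6; 27; 0; 12; 17; 35; 28]))))
  (Branch 3 (Branch 20 (Cover [:: 0; 6; 10; 38; 42; 35; 12; 28]) (Branch 13
  (Cover [:: 0; 6; 28; 12; 35; 16; 27; 4]) (Cover
  [:: 0; 6; 12; 28; 38; 35; 17]))) (Cover [:: 0; 6; 27; 13; 33; 36; 44])))))
  (Branch 18 (Cover [:: 6; 27; 0; 33; 13; 17; 36; 43]) (Branch 21 (Branch 22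
  (Cover [:: 7; 0; 13; 25; 29; 21; 17; 38]) (Branch 15 (Cover
  [:: 6; 27; 13; 0; 36; 17; 33; 43]) (Branch 17 (Branch 11 (Cover
  [:: 6; 27; 0; 12; 36; 16; 42; 29]) (Cover [:: 6; 0; 10; 42; 33; 36; 43]))
  (Cover [:: 6; 30; 4; 10; 33; 18; 40])))) (Branch 16 (Branch 22 (Cover
  [:: 11; 27; 22; 5; 34; 4; 35; 43]) (Branch 15 (Cover
  [:: 6; 10; 31; 18; 33; 43; 37; 4]) (Branch 17 (Branch 11 (Cover
  [:: 6; 27; 0; 12; 36; 16; 42; 29]) (Cover [:: 6; 0; 10; 33; 42; 36; 43]))
  (Cover [:: 6; 30; 18; 40; 10; 33; 4])))) (Branch 17 (Branch 11 (Cover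
  [:: 0; 10; 6; 37; 42; 36; 12; 29]) (Cover [:: 0; 6; 10; 42; 35; 34; 43]))
  (Cover [:: 0; 6; 27; 12; 17; 35; 40])))))))) (Branch 22 (Branch 21 (Branch
  20 (Branch 14 Full (Branch 19 (Branch 13 Full (Branch 10 Full (Cover
  [:: 0; 6; 28; 37; 16; 40; 14; 33]))) (Cover
  [:: 6; 15; 0; 38; 29; 13; 34; 41]))) (Branch 13 (Branch 19 Full (Branch 16
  (Branch 14 Full (Cover [:: 7; 11; 3; 31; 29; 23; 15; 38])) (Cover
  [:: 0; 6; 27; 43; 34; 15; 14; 35]))) (Cover
  [:: 6; 2; 10; 37; 19; 32; 36; 43]))) (Branch 16 (Branch 10 Full (Branch 14
  (Branch 13 Full (Cover [:: 0; 25; 22; 5; 29; 12; 37; 39])) (Cover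
  [:: 0; 6; 10; 33; 37; 40; 41; 28]))) (Branch 23 (Branch 20 (Branch 19
  (Branch 11 (Branch 3 Full (Cover [:: 0; 6; 27; 13; 43; 39; 34; 35])) (Cover
  [:: 0; 12; 8; 25; 15; 23; 29; 42])) (Cover
  [:: 0; 24; 21; 5; 29; 13; 34; 41])) (Branch 14 (Cover
  [:: 0; 6; 10; 27; 34; 35; 39; 43]) (Branch 10 (Cover
  [:: 0; 24; 8; 21; 10; 41; 34; 29]) (Branch 5 (Branch 2 (Cover
  [:: 6; 0; 27; 34; 39; 10; 3; 29]) (Branch 17 (Branch 11 (Cover
  [:: 6; 0; 27; 15; 34; 8; 43; 32]) (Cover [:: 6; 0; 41; 34; 15; 29; 8]))
  (Cover [:: 6; 0; 37; 39; 16; 29; 7]))) (Cover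
  [:: 0; 24; 41; 34; 10; 8; 29]))))) (Branch 10 (Cover
  [:: 0; 6; 27; 34; 13; 15; 43; 39]) (Branch 3 (Branch 20 (Branch 26 (Cover
  [:: 0; 6; 10; 43; 34; 39; 27; 13]) (Branch 19 (Cover
  [:: 0; 6; 10; 37; 43; 7; 40; 28]) (Cover [:: 0; 6; 13; 27; 43; 34; 15])))
  (Branch 25 (Branch 13 (Cover [:: 0; 7; 25; 23; 10; 8; 24; 43]) (Cover
  [:: 0; 34; 6; 10; 43; 39; 37])) (Cover [:: 6; 0; 28; 41; 12; 37; 15])))
  (Cover [:: 0; 6; 27; 13; 34; 39; 43])))))) (Branch 20 (Branch 26 (Branch 3
  (Branch 14 Full (Branch 11 (Branch 9 Full (Cover
  [:: 11; 5; 1; 35; 38; 40; 41; 28])) (Cover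
  [:: 0; 10; 6; 33; 40; 41; 36; 8]))) (Cover
  [:: 6; 0; 27; 13; 33; 36; 39; 43])) (Branch 14 (Branch 23 (Branch 21 (Branch
  3 Full (Cover [:: 6; 0; 35; 28; 12; 40; 38; 41])) (Cover
  [:: 0; 6; 12; 16; 35; 27; 40; 28])) (Cover
  [:: 0; 6; 15; 28; 13; 38; 43; 7])) (Branch 18 (Branch 23 (Branch 11 Full
  (Cover [:: 0; 6; 10; 36; 33; 40; 41; 8])) (Cover
  [:: 0; 6; 15; 38; 28; 13; 7; 43])) (Branch 15 (Branch 21 (Cover
  [:: 6; 10; 0; 38; 40; 7; 35; 28]) (Branch 25 (Branch 16 (Cover
  [:: 0; 40; 7; 10; 6; 35; 38; 28]) (Branch 9 (Cover
  [:: 5; 24; 1; 13; 18; 28; 33; 43]) (Cover [:: 11; 5; 35; 1; 40; 27; 28])))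
  (Cover [:: 6; 0; 13; 15; 27; 33; 28]))) (Branch 19 (Branch 10 (Cover
  [:: 0; 24; 28; 22; 7; 10; 36; 29]) (Branch 3 (Cover
  [:: 6; 19; 10; 2; 27; 31; 9; 35]) (Cover [:: 6; 19; 2; 27; 31; 14; 29])))
  (Cover [:: 6; 0; 10; 27; 33; 36; 40])))))) (Branch 21 (Branch 9 (Branch 15
  Full (Cover [:: 11; 5; 1; 27; 33; 36; 39; 43])) (Branch 15 (Branch 14
  (Branch 12 Full (Cover [:: 0; 25; 29; 21; 14; 16; 8; 27])) (Cover
  [:: 11; 5; 27; 3; 36; 22; 39; 29])) (Branch 14 (Branch 26 (Cover
  [:: 11; 5; 27; 43; 36; 1; 39; 33]) (Branch 12 (Cover
  [:: 6; 18; 10; 38; 32; 2; 43; 28]) (Branch 13 (Branch 19 (Cover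
  [:: 0; 25; 10; 21; 38; 7; 8; 29]) (Cover [:: 6; 27; 0; 36; 10; 43; 33]))
  (Cover [:: 6; 30; 19; 10; 3; 36; 29])))) (Branch 2 (Branch 17 (Branch 23
  (Cover [:: 11; 5; 27; 36; 39; 1; 16; 29]) (Branch 16 (Cover
  [:: 11; 5; 27; 36; 39; 43; 1; 16]) (Cover [:: 11; 28; 15; 9; 1; 41; 30])))
  (Branch 11 (Branch 23 (Cover [:: 11; 5; 27; 39; 1; 36; 16; 29]) (Cover
  [:: 11; 5; 38; 39; 1; 18; 43])) (Cover [:: 0; 14; 6; 15; 41; 29; 19])))
  (Cover [:: 5; 24; 41; 36; 1; 19; 29]))))) (Branch 26 (Branch 25 (Branch 3
  (Branch 17 (Branch 11 Full (Cover [:: 0; 10; 7; 43; 35; 39; 22; 25])) (Cover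
  [:: 0; 10; 6; 43; 33; 39; 18; 37])) (Branch 16 (Cover
  [:: 0; 6; 43; 33; 36; 39; 27; 13]) (Branch 17 (Branch 11 (Cover
  [:: 0; 6; 43; 27; 12; 39; 35; 25]) (Cover [:: 0; 6; 40; 28; 12; 35; 41]))
  (Cover [:: 0; 6; 43; 35; 27; 39; 12])))) (Branch 17 (Branch 16 (Cover
  [:: 6; 0; 15; 41; 28; 12; 38; 35]) (Branch 11 (Cover
  [:: 6; 0; 10; 35; 41; 24; 12; 28]) (Cover [:: 6; 15; 0; 41; 12; 28; 35])))
  (Cover [:: 6; 0; 16; 27; 12; 35; 39]))) (Branch 16 (Branch 15 (Cover
  [:: 0; 6; 12; 16; 27; 35; 28; 40]) (Branch 2 (Branch 17 (Cover
  [:: 11; 1; 5; 33; 43; 24; 18; 28]) (Branch 10 (Cover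
  [:: 11; 1; 5; 43; 19; 24; 7; 35]) (Cover [:: 11; 7; 1; 16; 30; 39; 29])))
  (Cover [:: 0; 6; 15; 33; 27; 43; 28]))) (Branch 12 (Branch 5 (Branch 18
  (Cover [:: 6; 0; 10; 35; 43; 24; 7; 28]) (Branch 15 (Branch 17 (Cover
  [:: 6; 10; 0; 7; 28; 35; 24; 43]) (Cover [:: 6; 10; 2; 18; 30; 8; 29]))
  (Cover [:: 0; 6; 12; 15; 27; 28; 29]))) (Cover
  [:: 0; 10; 7; 24; 35; 43; 28])) (Branch 9 (Branch 25 (Branch 19 (Cover
  [:: 6; 27; 0; 43; 10; 34; 35; 8]) (Cover [:: 6; 27; 0; 43; 10; 35; 34]))
  (Cover [:: 6; 27; 0; 35; 12; 16; 28])) (Branch 18 (Cover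
  [:: 0; 6; 35; 10; 43; 27; 28]) (Branch 15 (Cover
  [:: 0; 6; 10; 27; 35; 28; 43]) (Branch 14 (Cover
  [:: 0; 6; 10; 27; 28; 21; 29]) (Branch 10 (Cover
  [:: 0; 10; 6; 27; 28; 35; 43]) (Cover [:: 0; 6; 10; 27; 28; 29])))))))))))).

Lemma schlaefli_certified : certifies schlaefli_certificate base_kinds [::].
Proof. by vm_compute. Qed.

Lemma has_stableP k s : has_stable k s ->
  exists2 r, subseq r s /\ size r = k & pairwise (fun p q => ~~ adj27 p q) r.
Proof.
elim: k s => [|k IHk] s; first by exists [::]; rewrite ?sub0seq.
elim: s => //= p s IHs; case: ifP => [/IHk[r [rs szr] pr] _|_ /IHs[r [rs szr] pr]].
  exists (p :: r); rewrite /= ?szr ?pr ?andbT; last first.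
    apply/allP=> q /(mem_subseq rs); rewrite mem_filter; by case/andP.
  by rewrite eqxx (subseq_trans rs) ?filter_subseq.
exists r => //; split=> //; exact: subseq_trans rs (subseq_cons _ _).
Qed.

Lemma adj27C p q : adj27 p q = adj27 q p.
Proof. by rewrite /adj27 eq_sym madjC. Qed.

Lemma pairwise_clique s : pairwise adj27 s ->
  {in s &, forall p q, p != q -> adj27 p q}.
Proof.
elim: s => //= r s IH /andP[/allP rs /IH{}IH] p q.
rewrite !inE => /predU1P[->|ps] /predU1P[->|qs]; rewrite ?eqxx // => neq.
- exact: rs.
- by rewrite adj27C rs.
- exact: IH.
Qed.

(** [P] tells which of the 27 vertices occur; it selects one branch at each node, so [inn] and [out]
    stay correct down to the leaf. *)
Lemma certifiesP c inn out (P : pred nat) : certifies c inn out ->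
    all P inn -> all (predC P) out -> exists s ts,
  [/\ uniq s, all P s, {in s &, forall p q, ~~ adj27 p q}
    & [/\ size ts <= size s + 3, {in ts, forall r, pairwise adj27 r}
      & forall p, p < 27 -> P p -> has (fun r : seq nat => p \in r) ts]].
Proof.
elim: c inn out => [ts|p c1 IH1 c2 IH2] inn out; last first.
  move=> /= /andP[h1 h2] Pin Pout; have [Pp|nPp] := boolP (P p).
    by apply: IH1 h1 _ _ => //=; rewrite Pp.
  by apply: IH2 h2 _ _ => //=; rewrite nPp.
case/and3P=> uin /has_stableP[s [ss szs] st] /allP cov Pin Pout.
exists s, [seq nth [::] triangles i | i <- ts]; split.
- exact: subseq_uniq ss uin.
- by apply/allP=> p /(mem_subseq ss) /(allP Pin).
- move=> p q ps qs; move: st; rewrite pairwise_all2rel => [/allrelP||].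
  + exact.
  + by move=> r; rewrite /adj27 madj_diag.
  + by move=> p' q'; rewrite adj27C.
split.
- by rewrite size_map szs addnC -leq_subLR.
- move=> r /mapP[i _ ->].
  have [lti|] := ltnP i (size triangles); last by move=> lei; rewrite nth_default.
  by have := mem_nth [::] lti; rewrite mem_filter => /andP[].
move=> p ltp Pp; have /cov/orP[/(allP Pout)|] : p \in iota 0 27 by rewrite mem_iota.
  by rewrite /= Pp.
by rewrite has_map.
Qed.

(** * Sufficient conditions for goodness, in terms of the complement *)

Section Good.
Variable G : sgraph.
Implicit Types (x y w : G) (A S : {set G}).

Lemma stableP S : reflect {in S &, forall x y, ~~ adj x y} (stable S).
Proof.
apply: (iffP forall_inP) => [h x y xS yS|h x xS].
  by move/forall_inP: (h x xS); apply.
by apply/forall_inP=> y; apply: h.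
Qed.

Lemma stable_card_omega S : stable S -> #|S| <= omega (compl G).
Proof.
move/stableP=> stS; apply: (leq_bigmax_cond (P := @clique (compl G))).
apply/forall_inP=> x xS; apply/forall_inP=> y yS; apply/implyP=> neq.
by rewrite /adj /= /compl_adj neq stS.
Qed.

(** Passing to the complement turns adjacency into non-adjacency and reverses the inclusion of
    neighbourhoods, so the pair becomes comparable. *)
Lemma good_of_dominated x y :
  adj x y -> (forall w, w != x -> adj y w -> adj x w) -> good (compl G).
Proof.
move=> xy dom; left; exists x, y; split.
- by apply: contraTneq xy => ->; rewrite adj_irr.
- by rewrite /adj /= /compl_adj xy andbF.
left; apply/subsetP=> w; rewrite !inE /adj /= /compl_adj => /andP[xw nxw].
apply/andP; split; first by apply: contraNneq nxw => <-.
by apply: contra nxw; apply: dom; rewrite eq_sym.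
Qed.

Lemma good_of_isolated x : (forall w, ~~ adj x w) -> good (compl G).
Proof.
move=> iso; right; left; exists x => w neq.
by rewrite /adj /= /compl_adj eq_sym neq iso.
Qed.

Lemma good_of_nice x :
  #|[set w | (x != w) && ~~ adj x w]| <= omega (compl G) + 2 -> good (compl G).
Proof. by move=> le; right; right; left; exists x. Qed.

(** Colouring each vertex by the position of the first clique containing it is proper in the
    complement, where [S] is a clique and bounds omega from below. *)
Lemma good_of_cover (cs : seq {set G}) S :
    (forall c : {set G}, c \in cs -> {in c &, forall x y, x != y -> adj x y}) ->
    (forall x, has (fun c : {set G} => x \in c) cs) -> stable S ->
  size cs <= #|S| + 3 -> good (compl G).
Proof.
move=> clq cov /stable_card_omega leS lecs; do 4!right.
apply: (leq_trans _ (leq_trans lecs (leq_add leS (leqnn 3)))).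
rewrite /chi; case: ex_minnP => k _; apply.
have findlt x : find (fun c : {set G} => x \in c) cs < size cs.
  by rewrite -has_find.
apply/existsP; exists [ffun x => Ordinal (findlt x)].
apply/forallP=> x; apply/forallP=> y; apply/implyP=> /andP[neq nadj].
rewrite !ffunE; apply: contra nadj => /eqP/(congr1 val) /= eqf.
apply: (clq (nth set0 cs (find (fun c : {set G} => x \in c) cs))) => //.
- exact: mem_nth.
- exact: (nth_find set0 (cov x)).
- by rewrite eqf; apply: (nth_find set0 (cov y)).
Qed.

End Good.

(** * Vertices around an induced co-H3 *)

Section Structure.
Variables (G : sgraph) (v1 v2 v3 v4 b t : G).
Implicit Types (x y z w : G) (vs : seq G).
Let base := [:: v1; v2; v3; v4; b; t].
Hypothesis free : forall vs, uniq vs -> ~~ bad (amx vs).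
Hypothesis base_uniq : uniq base.
Hypothesis base_amx : amx base = base_mx.

Definition sig x := [seq adj x y | y <- base].

Lemma sig_base x : x \in base -> exists2 k, k \in base_kinds & sig x = ksig k.
Proof.
move=> xb; have lt : index x base < 6 by rewrite -[6]/(size base) index_mem.
have := congr1 (fun m => nth [::] m (index x base)) base_amx.
rewrite /base_mx (nth_map x) // (nth_map 0) // nth_index // => sigE.
by exists (nth 0 base_kinds (index x base)); [apply: mem_nth | apply: sigE].
Qed.

Lemma sig_new x : x \notin base -> sig x \in sigs.
Proof.
move=> xb; have := allP type_check _ (mem_bools (sig x)); case: ifP => // _.
by rewrite -base_amx -amx_cons (negPf (free _)) //= xb.
Qed.

Lemma sig_pair x y : x \notin base -> y \notin base -> x != y ->
  ~~ bad (ext (adj x y :: sig x) (ext (sig y) base_mx)).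
Proof.
move=> xb yb neq; rewrite -base_amx -amx_cons -(amx_cons x (y :: base)).
by apply: free; rewrite /= inE negb_or neq xb yb.
Qed.

Lemma sig_triple x y z :
    all [predC base] [:: x; y; z] -> uniq [:: x; y; z] ->
  ~~ bad (ext [:: adj x y, adj x z & sig x]
            (ext (adj y z :: sig y) (ext (sig z) base_mx))).
Proof.
move=> nb uxyz; rewrite -base_amx -amx_cons -(amx_cons y (z :: base)).
rewrite -(amx_cons x [:: y, z & base]); apply: free.
rewrite -[X in uniq X]/([:: x; y; z] ++ base) cat_uniq uxyz base_uniq andbT.
by apply/hasPn=> u ub; apply/negP=> /(allP nb) /=; rewrite ub.
Qed.

Lemma sig_four x y z w :
    all [predC base] [:: x; y; z; w] -> uniq [:: x; y; z; w] ->
  ~~ bad (ext [:: adj x y, adj x z, adj x w & sig x]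
            (ext [:: adj y z, adj y w & sig y]
               (ext (adj z w :: sig z) (ext (sig w) base_mx)))).
Proof.
move=> nb uxyz; rewrite -base_amx -amx_cons -(amx_cons z (w :: base)).
rewrite -(amx_cons y [:: z, w & base]) -(amx_cons x [:: y, z, w & base]).
apply: free; rewrite -[X in uniq X]/([:: x; y; z; w] ++ base).
rewrite cat_uniq uxyz base_uniq andbT.
by apply/hasPn=> u ub; apply/negP=> /(allP nb) /=; rewrite ub.
Qed.


Lemma base_adj i j : i < 6 -> j < 6 ->
  adj (nth v1 base i) (nth v1 base j) = entry base_mx i j.
Proof. by move=> lti ltj; rewrite -base_amx (entry_amx v1). Qed.

Lemma sig_notin_base x : sig x \notin base_mx -> x \notin base.
Proof.
by apply: contra => /sig_base[k kb ->]; apply: map_f.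
Qed.

Lemma sig_all_complete x y : sig x = sig_all -> x != y ->
    sig y \notin [:: sig_none; sig_v1v2; ksig 10; ksig 14] -> adj x y.
Proof.
move=> sx neq sy; have xb : x \notin base by apply: sig_notin_base; rewrite sx.
have [yb|yb] := boolP (y \in base).
  have : adj x y \in sig x by apply: map_f.
  by rewrite sx mem_nseq => /eqP.
have := allP pair_check_all _ (sig_new yb); rewrite (negPf sy).
by have := sig_pair xb yb neq; rewrite sx; case: (adj x y) => // /negPf->.
Qed.

Lemma adj_neq x y : adj x y -> x != y.
Proof. by apply: contraTneq => ->; rewrite adj_irr. Qed.

(** * Traces outside the grid model *)

(** An induced three-vertex path in [W] would form P2+P3 with the edge v3v4, so [r] is an
    equivalence on [W] whose blocks are cliques. A transversal [S] is stable with one vertex per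
    block; {v3, v4}, {v1, v2} and the full-trace vertices are the three extra cliques. *)
Lemma good_of_no_attachment :
    (forall x, x \notin base ->
       sig x \in [:: sig_none; sig_v1v2; sig_all; ksig 10; ksig 14]) ->
  good (compl G).
Proof.
move=> few; pose W := [set x | ~~ adj v3 x && ~~ adj v4 x].
pose r x y := (x == y) || adj x y.
have P3free x y z : x \in W -> y \in W -> z \in W ->
    adj x y -> adj y z -> x != z -> adj x z.
  rewrite !inE => /andP[x3 x4] /andP[y3 y4] /andP[z3 z4] xy yz xz.
  apply: contraTT isT => nxz.
  have : uniq [:: v3; v4; x; y; z].
    have neq u w : ~~ adj v3 u -> ~~ adj v4 u -> adj v3 w || adj v4 w -> w != u.
      by move=> u3 u4; apply: contraTneq => ->; rewrite negb_or u3.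
    have e34 : adj v3 v4 by apply: (base_adj (i := 2) (j := 3)).
    have e43 : adj v4 v3 by rewrite adj_sym.
    rewrite /= !inE !negb_or xz (adj_neq e34) (adj_neq xy) (adj_neq yz) /= andbT.
    by rewrite !neq ?e34 ?e43 ?orbT.
  move/free; rewrite !amx_cons /=.
  rewrite xy yz (negPf nxz) (negPf x3) (negPf y3) (negPf z3).
  rewrite (negPf x4) (negPf y4) (negPf z4).
  by rewrite (base_adj (i := 2) (j := 3)).
have req : {in W & &, equivalence_rel r}.
  move=> x y z xW yW zW; rewrite /r eqxx; split=> // /predU1P[->//|xy].
  have [xz|nxz] := eqVneq x z; first by rewrite -xz [adj y x]adj_sym xy orbT.
  have [yz|nyz] := eqVneq y z; first by rewrite -yz xy.
  rewrite /=; apply/idP/idP=> h.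
    by apply: (P3free y x z) => //; rewrite adj_sym.
  exact: (P3free x y z).
pose P := equivalence_partition r W.
have partP : partition P W by apply: equivalence_partitionP.
have trS := transversalP partP; set S := transversal P W in trS.
have SW := subsetP (transversal_sub trS).
pose cs := [:: [set v3; v4], [set v1; v2], [set x | sig x == sig_all] & enum P].
have szcs : size cs <= #|S| + 3.
  by rewrite /= -cardE (card_transversal trS) addn3.
have adj2 i j : i < 6 -> j < 6 -> entry base_mx i j ->
    {in [set nth v1 base i; nth v1 base j] &, forall x y, x != y -> adj x y}.
  move=> lti ltj; rewrite -base_adj // => ij x y.
  rewrite !inE => /orP[]/eqP-> /orP[]/eqP->; rewrite ?eqxx // => _.
  by rewrite adj_sym.
apply: good_of_cover szcs.
- move=> c; rewrite !inE => /or4P[/eqP->|/eqP->|/eqP->|].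
  + exact: (adj2 2 3).
  + exact: (adj2 0 1).
  + move=> x y; rewrite !inE => /eqP sx /eqP sy neq.
    by apply: sig_all_complete => //; rewrite sy.
  rewrite mem_enum => cP x y xc yc neq.
  have [/eqP cov tI _] := and3P partP.
  have cW z : z \in c -> z \in W by move=> zc; rewrite -cov; apply/bigcupP; exists c.
  have := pblock_equivalence_partition req (cW x xc) (cW y yc).
  by rewrite -/P (def_pblock tI cP xc) yc /r (negPf neq).
- move=> x; have [xW|] := boolP (x \in W).
    have xP : pblock P x \in P by rewrite pblock_mem ?(cover_partition partP).
    apply/hasP; exists (pblock P x); first by rewrite !inE mem_enum xP !orbT.
    by rewrite mem_pblock (cover_partition partP).
  rewrite !inE => xW; apply/hasP.
  have [xb|xb] := boolP (x \in base).
    move: xb; rewrite !inE => /or4P[||/eqP xE|/or3P[]]; last 2 first.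
    + move/eqP=> xE; rewrite xE in xW.
      by rewrite (base_adj (i := 2) (j := 4)) // (base_adj (i := 3) (j := 4)) in xW.
    + move/eqP=> xE; rewrite xE in xW.
      by rewrite (base_adj (i := 2) (j := 5)) // (base_adj (i := 3) (j := 5)) in xW.
    + by move=> x1; exists [set v1; v2]; rewrite !inE ?eqxx ?orbT ?x1.
    + by move=> x1; exists [set v1; v2]; rewrite !inE ?eqxx ?orbT ?x1 ?orbT.
    + by exists [set v3; v4]; rewrite !inE ?eqxx // xE eqxx.
    + by move=> x1; exists [set v3; v4]; rewrite !inE ?eqxx // x1 orbT.
  exists [set x | sig x == sig_all]; rewrite !inE ?eqxx ?orbT //.
  apply: contraTT xW => sx; rewrite ![adj _ x]adj_sym.
  have := few x xb; rewrite !inE (negPf sx) /=.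
  by case/or4P=> /eqP[] _ _ -> ->.
apply/stableP=> x y xS yS; apply/negP=> xy.
have := pblock_equivalence_partition req (SW x xS) (SW y yS).
rewrite /r xy orbT => yx; have [_ tI _] := and3P partP.
have := pblock_inj trS xS yS; rewrite (same_pblock tI yx) => /(_ erefl) E.
by rewrite E adj_irr in xy.
Qed.




Lemma no_sig_v1v2 z x : z \notin base ->
  sig z \in map ksig attached -> sig x != sig_v1v2.
Proof.
move=> zb sz; apply/eqP=> sx.
have xb : x \notin base by apply: sig_notin_base; rewrite sx.
have neq : x != z by apply: contraTneq sz => <-; rewrite sx.
case/mapP: sz => k kin sz; have /allP/(_ (adj x z)) := allP pair_check_v1v2 k kin.
have := sig_pair xb zb neq; rewrite sx sz => /negPf-> h.
by apply: (notF (h _)); case: (adj x z).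
Qed.

(** All neighbours of [x] have full trace and are pairwise adjacent, so any of them dominates [x];
    without neighbours [x] is isolated. *)
Lemma good_of_sig_none x : (forall w, sig w != sig_v1v2) ->
  sig x = sig_none -> good (compl G).
Proof.
move=> no12 sx; have xb : x \notin base by apply: sig_notin_base; rewrite sx.
have nbx w : adj x w -> sig w = sig_all.
  move=> xw; have wb : w \notin base.
    apply: contraTN xw => wb; have : adj x w \in sig x by apply: map_f.
    by rewrite sx mem_nseq => /eqP->.
  have := allP pair_check_none _ (sig_new wb).
  have := sig_pair xb wb (adj_neq xw); rewrite sx xw => /negPf->.
  by rewrite !inE (negPf (no12 w)); case: eqP.
have [/existsP[d xd]|/existsPn iso] := boolP [exists w, adj x w]; last first.
  exact: good_of_isolated iso.
apply: (@good_of_dominated _ d x) => [|w nwd /nbx sw]; first by rewrite adj_sym.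
by apply: sig_all_complete; rewrite ?(nbx d xd) ?sw // eq_sym.
Qed.

(** If [d] misses some [x], then [x] has the trace of kind 10 or 14 and its only base neighbour [y]
    dominates it. Otherwise [d] sees all other vertices and dominates v1. *)
Lemma good_of_sig_all d :
    (forall w, (sig w != sig_v1v2) && (sig w != sig_none)) ->
  sig d = sig_all -> good (compl G).
Proof.
move=> nosig sd; have db : d \notin base by apply: sig_notin_base; rewrite sd.
have [/existsP[x /andP[sx ndx]]|/existsPn compl_d] :=
  boolP [exists x, (sig x \in [:: ksig 10; ksig 14]) && ~~ adj d x].
  have xb : x \notin base.
    by apply: sig_notin_base; move: sx; rewrite !inE => /orP[]/eqP->.
  have [k kin sxk] : exists2 k, k \in [:: 10; 14] & sig x = ksig k.
    by move: sx; rewrite !inE => /orP[]/eqP->; [exists 10 | exists 14].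
  pose y := nth v1 base (k == 10).
  have xy : adj x y.
    have : nth false (sig x) (k == 10).
      by rewrite sxk; move: kin; rewrite !inE => /orP[]/eqP->.
    by rewrite (nth_map v1) // (leq_ltn_trans (leq_b1 _)).
  apply: (@good_of_dominated _ y x) => [|w nwy xw]; first by rewrite adj_sym.
  have wx : adj w x by rewrite adj_sym.
  have [wb|wb] := boolP (w \in base).
    case/negP: nwy; have lti : index w base < 6 by rewrite -[6]/(size base) index_mem.
    have := xw; rewrite -(nth_index v1 wb) -(nth_map v1 false (adj x)) // -/(sig x) sxk /y.
    move: (index w base) lti kin; rewrite !inE => i lti /orP[]/eqP->.
      by move: i lti; do 6!case=> //.
    by move: i lti; do 6!case=> //.
  have nwd : w != d by apply: contraNneq ndx => <-.
  have nxd : x != d by apply: contraTneq sx => ->; rewrite sd.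
  have := allP (allP triple_check_all k kin) _ (sig_new wb) => /allP/(_ (adj w d)).
  have sub : all [predC base] [:: x; w; d] by rewrite /= xb wb db.
  have un : uniq [:: x; w; d] by rewrite /= !inE negb_or (adj_neq xw) nxd nwd.
  have := sig_triple sub un.
  rewrite sxk sd xw [adj x d]adj_sym (negPf ndx) => /negPf->.
  have /andP[n12 n0] := nosig w.
  rewrite !inE (negPf n0) (negPf n12) /= (nth_map v1) ?(leq_ltn_trans (leq_b1 _)) //.
  move=> h; have : (if adj w y then true else false) by apply: h; case: (adj w d).
  by rewrite adj_sym; case: ifP.
apply: (@good_of_dominated _ d v1) => [|w nwd _].
  have : adj d v1 \in sig d by apply: map_f; rewrite inE eqxx.
  by rewrite sd mem_nseq => /eqP.
have := compl_d w; rewrite negb_and negbK orbC => /orP[//|sw].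
have /andP[n12 n0] := nosig w.
apply: sig_all_complete => //; first by rewrite eq_sym.
by move: sw; rewrite !inE !negb_or n0 n12.
Qed.

(** The continuation form absorbs the cases that are good outright; in what remains only the fifteen
    traces of the model occur. *)
Lemma good_of_kinds : (forall kind : G -> nat, (forall x, kind x < 15) ->
    (forall x, sig x = ksig (kind x)) -> good (compl G)) -> good (compl G).
Proof.
move=> goodK.
have [/existsP[z /andP[zb sz]]|/existsPn noatt] :=
  boolP [exists z, (z \notin base) && (sig z \in map ksig attached)]; last first.
  apply: good_of_no_attachment => x xb; have := noatt x; rewrite xb /=.
  have := sig_new xb; rewrite /sigs /attached !inE.
  by do 11?[case: eqP => //= _].
have no12 x := no_sig_v1v2 x zb sz.
have [/existsP[x /eqP sx]|/existsPn no0] := boolP [exists x, sig x == sig_none].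
  exact: good_of_sig_none sx.
have [/existsP[x /eqP sx]|/existsPn noall] := boolP [exists x, sig x == sig_all].
  by apply: good_of_sig_all sx => w; rewrite no12 no0.
have sig_kind x : sig x \in map ksig (iota 0 15).
  have [/sig_base[k kb ->]|xb] := boolP (x \in base).
    by apply: map_f; move: k kb; apply/allP.
  have := sig_new xb; rewrite /sigs 3!in_cons.
  rewrite (negPf (no12 x)) (negPf (no0 x)) (negPf (noall x)).
  by move=> /mapP[k kb ->]; apply: map_f; move: k kb; apply/allP.
pose kind x := index (sig x) (map ksig (iota 0 15)).
have ltk x : kind x < 15.
  by rewrite -[15]/(size (map ksig (iota 0 15))) index_mem.
apply: (goodK kind ltk) => x; have := nth_index [::] (sig_kind x).
by rewrite -/(kind x) (nth_map 0) ?size_iota // nth_iota.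
Qed.


(** * Kinds and labels *)

Section Kinds.
Variable kind : G -> nat.
Hypothesis kind_lt : forall x, kind x < 15.
Hypothesis sigE : forall x, sig x = ksig (kind x).

Lemma kind_mem x : kind x \in iota 0 15.
Proof. by rewrite mem_iota kind_lt. Qed.

Lemma kind_unique x k : k < 15 -> sig x = ksig k -> kind x = k.
Proof.
move=> ltk; rewrite sigE => /eqP ek; apply/eqP.
have kin : k \in iota 0 15 by rewrite mem_iota.
have /allP/(_ _ (kind_mem x))/allP/(_ _ kin)/implyP := isT : all (fun l => all (fun k =>
  (ksig l == ksig k) ==> (l == k)) (iota 0 15)) (iota 0 15).
exact.
Qed.

Lemma kind_base i : i < 6 -> kind (nth v1 base i) = nth 0 base_kinds i.
Proof.
move=> lti; apply: kind_unique; first by move: i lti; do 6!case=> //.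
have -> : sig (nth v1 base i) = nth [::] base_mx i.
  by rewrite -base_amx (nth_map v1).
by move: i lti; do 6!case=> //.
Qed.

Lemma kind_new x : x \notin base -> kind x \in extra_kinds.
Proof.
have /allP/(_ _ (kind_mem x))/implyP :
    all (fun k => (ksig k \in sigs) ==> (k \in extra_kinds)) (iota 0 15) by [].
by move=> h /sig_new; rewrite sigE.
Qed.

Lemma base_of_kind x : kind x \in base_kinds -> x \in base.
Proof.
apply: contraTT => /kind_new; move: (kind x) => k.
by move: k; apply/allP.
Qed.

Definition bv k := nth v1 base (index k base_kinds).

Lemma kind_bv k : k \in base_kinds -> kind (bv k) = k.
Proof. by move=> kb; rewrite kind_base ?nth_index // -[6]/(size base_kinds) index_mem. Qed.

Lemma baseE x : x \in base -> x = bv (kind x).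
Proof.
move=> xb; have lti : index x base < 6 by rewrite -[6]/(size base) index_mem.
rewrite -{2}(nth_index v1 xb) kind_base // /bv index_uniq ?nth_index //.
Qed.

(* "Same label"; a cell has no label and is related to itself only. *)
Definition same x y :=
  (x == y) || [&& 8 < kind x, 8 < kind y, kind x != kind y
                & adj x y == madj (kind x) (kind y) true].

Lemma sameC x y : same x y = same y x.
Proof.
rewrite /same [y == x]eq_sym [kind y == _]eq_sym [adj y x]adj_sym.
by rewrite (madjC (kind y)) andbCA.
Qed.

Lemma samexx x : same x x.
Proof. by rewrite /same eqxx. Qed.

Lemma kind_in_base x : x \in base -> kind x \in base_kinds.
Proof.
move=> xb; have lti : index x base < 6 by rewrite -[6]/(size base) index_mem.
by rewrite -(nth_index v1 xb) kind_base // mem_nth.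
Qed.

Lemma class_new x : 8 < kind x -> x \notin base.
Proof.
apply: contraTN => /kind_in_base; rewrite -leqNgt.
by move: (kind x); apply/allP.
Qed.

Lemma same_kind x y : same x y -> kind x = kind y -> x = y.
Proof. by case/predU1P=> // /and4P[_ _ /eqP]. Qed.

(** No further vertex has the kind of a base vertex, and two vertices in one of the other three
    cells are excluded by [pair_check]. *)
Lemma special_inj x y : kind x < 9 -> kind x = kind y -> x = y.
Proof.
move=> ltx kxy; have [xb|xb] := boolP (x \in base).
  have yb : y \in base by apply: base_of_kind; rewrite -kxy kind_in_base.
  by rewrite (baseE xb) (baseE yb) kxy.
have yb : y \notin base.
  by apply: contra xb => /kind_in_base; rewrite -kxy => /base_of_kind.
apply/eqP; apply: contraTT isT => neq.
have := sig_pair xb yb neq; rewrite !sigE => /negPf nbad.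
have := allP (allP pair_check _ (kind_new xb)) _ (kind_new yb).
move/allP/(_ (adj x y)); rewrite nbad.
have -> : adj x y \in [:: true; false] by case: (adj x y).
by move/(_ isT); rewrite -kxy eqxx ltx andbF.
Qed.

(** Against a base vertex the trace decides; for two distinct classes the definition of [same] does;
    [pair_check] settles the remaining pairs. *)
Lemma adjE x y : adj x y = madj (kind x) (kind y) (same x y).
Proof.
have [->|neq] := eqVneq x y; first by rewrite adj_irr madj_diag.
have half z w : z \in base -> adj z w = madj (kind z) (kind w) (same z w).
  move=> zb; have lti : index z base < 6 by rewrite -[6]/(size base) index_mem.
  rewrite (@madj_special _ _ _ false); last first.
    by rewrite ltnNge; apply: contraL zb => /class_new.
  rewrite adj_sym -{1}(nth_index v1 zb) -(nth_map v1 false (adj w)) // -/(sig w).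
  by rewrite sigE (nth_map 0) // madjC -kind_base // nth_index.
have [xb|xb] := boolP (x \in base); first exact: half.
have [yb|yb] := boolP (y \in base); first by rewrite adj_sym madjC sameC half.
have [|nk] := boolP ((kind x != kind y) && (8 < kind x) && (8 < kind y)).
  case/andP=> /andP[nk kx] ky; rewrite [RHS]madj_class // /same (negPf neq) nk kx ky /=.
  by case: (adj x y); case: (madj _ _ _).
have -> : same x y = false.
  by rewrite /same (negPf neq); move: nk; case: (8 < kind x); case: (8 < kind y);
    case: (kind x != kind y).
have := allP (allP pair_check _ (kind_new xb)) _ (kind_new yb).
move/allP/(_ (adj x y)); rewrite (negPf nk) -!sigE (negPf (sig_pair xb yb neq)).
have -> : adj x y \in [:: true; false] by case: (adj x y).
by move/(_ isT); case: ifP => // /andP[/eqP].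
Qed.

Lemma adj_diff x y : ~~ same x y -> adj x y = madj (kind x) (kind y) false.
Proof. by rewrite adjE => /negPf->. Qed.

Lemma class_kind x : 8 < kind x -> kind x \in class_kinds.
Proof. by have := kind_lt x; move: (kind x); do 15!case=> //. Qed.

(** When [x] and [z] lie in one class, this with [same_kind] yields [x = z]: a class has at most one
    vertex per label. *)
Lemma same_trans x y z : same x y -> same y z -> same x z.
Proof.
case/predU1P=> [->//|/and4P[kx ky nxy /eqP axy]].
case/predU1P=> [<-|/and4P[_ kz nyz /eqP ayz]].
  by rewrite /same kx ky nxy axy eqxx orbT.
apply: contraTT isT => nxz.
have := allP (allP (allP triple_check _ (class_kind kx)) _ (class_kind ky)) _
          (class_kind kz).
rewrite (negPf nxy) (negPf nyz) -axy -ayz -adj_diff // -!sigE.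
apply: contraLR => _; apply: sig_triple; first by rewrite /= !class_new.
rewrite /= !inE negb_or andbT -andbA; apply/and3P; split.
- by apply: contraNneq nxy => ->.
- by apply: contraNneq nxz => ->; apply: samexx.
- by apply: contraNneq nyz => ->.
Qed.

Lemma same_diff x y z : same x y -> ~~ same y z -> ~~ same x z.
Proof.
by move=> xy; apply: contra => xz; apply: same_trans xz; rewrite sameC.
Qed.

Lemma diff_neq x y : ~~ same x y -> x != y.
Proof. by apply: contraNneq => ->; apply: samexx. Qed.

Lemma four_labels x y z w : all (fun u => 8 < kind u) [:: x; y; z; w] ->
    pairwise (fun u v => ~~ same u v) [:: x; y; z; w] ->
    uniq [:: kind x; kind y; kind z] ->
  (kind w \in [:: kind x; kind y; kind z]) && is_triad [:: kind x; kind y; kind z].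
Proof.
move=> cls pw u3; have := cls; rewrite /= andbT => /and4P[cx cy cz cw].
have := pw; rewrite /= !andbT -!andbA => /and5P[nxy nxz nxw nyz /andP[nyw nzw]].
have := allP (allP (allP (allP four_check _ (class_kind cx)) _ (class_kind cy)) _
          (class_kind cz)) _ (class_kind cw).
rewrite /four_ok u3 orFb -!adj_diff // -!sigE; case: ifP => // _.
apply: contraLR => _; apply: sig_four; first by rewrite /= !class_new.
by rewrite /= !inE !negb_or !diff_neq.
Qed.

(** * Stable sets containing a class, and nice base vertices *)

Definition cls c := [set x | kind x == c].

Lemma omega_class c (s : seq G) : 8 < c -> uniq s ->
    {in s, forall x, kind x != c} -> {in s &, forall x y, ~~ adj x y} ->
    (forall x y, x \in s -> kind y = c -> ~~ adj x y) ->
  #|cls c| + size s <= omega (compl G).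
Proof.
move=> c8 us sc ss sadj.
have dis : cls c :&: [set x in s] = set0.
  by apply/setP=> x; rewrite !inE; apply/andP=> -[/eqP kx /sc /eqP].
rewrite -(card_uniqP us) -[#|s|]cardsE -cardsUI dis cards0 addn0.
apply: stable_card_omega; apply/stableP=> x y.
rewrite !inE => /orP[/eqP kx|xs] /orP[/eqP ky|ys].
- by rewrite adjE kx ky madj_diag.
- by rewrite adj_sym sadj.
- exact: sadj.
- exact: ss.
Qed.

(* The base vertices of kinds ks extend the class c to a stable set. *)
Definition fits c ks := [&& uniq ks, all [in base_kinds] ks,
  allrel (fun k l => ~~ madj k l false) ks ks & all (fun k => ~~ madj k c false) ks].

Lemma fits_bv c ks : fits c ks ->
  [/\ uniq (map bv ks), {in map bv ks, forall x, kind x < 9},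
      {in map bv ks &, forall x y, ~~ adj x y}
    & forall x y, x \in map bv ks -> kind y = c -> ~~ adj x y].
Proof.
case/and4P=> uks /allP kb /allrelP kk /allP kc.
have kind9 x : x \in map bv ks -> kind x \in ks /\ kind x < 9.
  case/mapP=> k kks ->; rewrite kind_bv ?kb //; split=> //.
  by move: k {kks} (kb k kks); apply/allP.
split.
- rewrite map_inj_in_uniq // => k l /kb kb1 /kb lb1 /(congr1 kind).
  by rewrite !kind_bv.
- by move=> x /kind9[].
- move=> x y /kind9[kx lt] /kind9[ky _].
  by rewrite adjE (@madj_special _ _ _ false) // kk.
- move=> x y /kind9[kx lt] ky.
  by rewrite adjE (@madj_special _ _ _ false) // ky kc.
Qed.

Lemma omega_fits c ks : 8 < c -> fits c ks -> #|cls c| + size ks <= omega (compl G).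
Proof.
move=> c8 /fits_bv[uks k9 kk kc]; rewrite -(size_map bv); apply: omega_class => //.
by move=> x /k9 lt; rewrite ltn_eqF // (leq_trans lt).
Qed.

Lemma omega_class2 c : c \in class_kinds -> #|cls c| + 2 <= omega (compl G).
Proof.
have /allP h : all (fun c => (8 < c) &&
    has (fits c) [:: [:: 8; 6]; [:: 1; 0]; [:: 4; 1]; [:: 0; 6]]) class_kinds by [].
case/h/andP=> c8 /hasP[ks]; rewrite !inE.
by case/or4P=> /eqP-> /(omega_fits c8).
Qed.

(** Row 2 (v1, v3, t) and column 1 (v2, v4, t) are the only grid lines filled by base vertices. A
    line is stable and is missed by the classes of the parallel lines; 11 and 13 are the classes of
    the filled lines themselves. *)
Lemma omega_class3 c : c \in [:: 9; 10; 12; 14] -> #|cls c| + 3 <= omega (compl G).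
Proof.
have /allP h : all (fun c => (8 < c) &&
    has (fits c) [:: [:: 8; 6; 7]; [:: 4; 1; 7]]) [:: 9; 10; 12; 14] by [].
by case/h/andP=> c8 /hasP[ks]; rewrite !inE => /orP[]/eqP-> /(omega_fits c8).
Qed.

Lemma card_le_kinds (A : {set G}) s : {in A &, injective kind} ->
  {in A, forall x, kind x \in s} -> #|A| <= size s.
Proof.
move=> injA As; rewrite cardE -(size_map kind); apply: uniq_leq_size.
  by rewrite map_inj_in_uniq ?enum_uniq // => x y; rewrite !mem_enum; apply: injA.
by move=> k /mapP[x]; rewrite mem_enum => xA ->; apply: As.
Qed.

(* The class vertices outside the row and the column of the cell k; its other
   non-neighbours are at most four cells. *)
Definition rest k :=
  [set w | [&& 8 < kind w, kind w != 9 + k %/ 3 & kind w != 12 + k %% 3]].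

Definition near k := [seq l <- iota 0 9 | (l != k) && ~~ madj k l false].

(** In the complement [bv k] has degree at most [#|rest k| + 4], as a cell holds at most one vertex;
    this is at most omega + 2. *)
Lemma good_of_rest k :
  k \in base_kinds -> #|rest k| + 2 <= omega (compl G) -> good (compl G).
Proof.
move=> kb le; apply: (@good_of_nice _ (bv k)).
have szn : size (near k) = 4 by apply/eqP; move: k kb {le}; apply/allP.
have k9 : k < 9 by move: k kb {le szn}; apply/allP.
apply: (@leq_trans (#|[set w | kind w \in near k]| + #|rest k|)); last first.
  have : #|[set w | kind w \in near k]| <= 4.
    rewrite -szn; apply: card_le_kinds => [x y|x]; rewrite !inE //.
    by rewrite mem_filter mem_iota => /andP[_ lt9] _; apply: special_inj.
  by move=> le4; rewrite -(leq_add2r 2) -addnA (leq_trans (leq_add le4 le)) // -addnA addnC.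
apply: leq_trans (leq_card_setU _ _); apply/subset_leq_card/subsetP=> w.
rewrite !inE mem_filter mem_iota /= add0n adjE kind_bv // => /andP[neq].
rewrite (@madj_special _ _ _ false) // => nadj; rewrite nadj andbT.
have /andP[m1 m2] : madj k (9 + k %/ 3) false && madj k (12 + k %% 3) false.
  by move: k kb {le szn k9 neq nadj}; apply/allP.
case: (leqP 9 (kind w)) => kw; rewrite ?andbT ?andbF /=.
  by apply/andP; split; apply: contraNneq nadj => ->.
rewrite orbF; apply: contraNneq neq => kwk; apply/eqP.
by apply: special_inj; rewrite kind_bv.
Qed.

(** * At least four labels *)

(** The three classes form a triad; for the base vertex from [triad_base], [rest] lies in the third
    class [m] and [out], so [#|out| <= 1] suffices. A vertex of [out] has the label of [x] or of [y]
    and can replace it in the triad; [link_check] leaves room for only one. *)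
Lemma good_of_two_in_triad x y z u :
    all (fun w => 8 < kind w) [:: x; y; z; u] ->
    pairwise (fun v w => ~~ same v w) [:: x; y; z; u] ->
  uniq [:: kind x; kind y; kind z] -> kind u = kind z -> good (compl G).
Proof.
move=> cl pw uk ku; have := cl; rewrite /= andbT => /and4P[cx cy cz cu].
have := pw; rewrite /= !andbT -!andbA => /and5P[nxy nxz nxu nyz /andP[nyu nzu]].
have /andP[_ tri] := four_labels cl pw uk.
have := uk; rewrite /= !inE negb_or andbT -andbA => /and3P[kxy kxz kyz].
pose out := [set w | (8 < kind w) && (kind w \notin [:: kind x; kind y; kind z])].
have outP w : w \in out ->
    same w x /\ is_triad [:: kind w; kind y; kind z] \/
    same w y /\ is_triad [:: kind x; kind w; kind z].
  rewrite inE => /andP[cw kw].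
  have := kw; rewrite !inE !negb_or => /and3P[kwx kwy kwz].
  have [wx|nwx] := boolP (same w x).
    left; split=> //; have nw v := same_diff (z := v) wx.
    have /andP[] // : (kind u \in [:: kind w; kind y; kind z]) &&
      is_triad [:: kind w; kind y; kind z].
    apply: four_labels; rewrite /= ?cw ?cy ?cz ?cu //.
      by rewrite !nw // nyz nyu nzu.
    by rewrite !inE negb_or kwy kwz kyz.
  have [wy|nwy] := boolP (same w y).
    right; split=> //; have nw v := same_diff (z := v) wy.
    have /andP[] // : (kind u \in [:: kind x; kind w; kind z]) &&
      is_triad [:: kind x; kind w; kind z].
    apply: four_labels; rewrite /= ?cw ?cx ?cz ?cu //.
      by rewrite sameC nwx nxz nxu !nw // nzu.
    by rewrite !inE negb_or eq_sym kwx kxz kwz.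
  (* At least one of [z] and [u] has a label other than that of [w]. *)
  exfalso; have [z' [kz' cz' nxz' nyz' nwz']] : exists z',
      [/\ kind z' = kind z, 8 < kind z', ~~ same x z', ~~ same y z' & ~~ same w z'].
    have [wz|nwz] := boolP (same w z); last by exists z.
    by exists u; split=> //; apply: same_diff wz _.
  have := @four_labels x y z' w; rewrite kz' uk (negPf kw) => h.
  suff : false by []; apply: h => //=; first by rewrite cx cy cw cz'.
  by rewrite nxy nxz' nyz' ![same _ w]sameC nwx nwy nwz'.
have out1 : #|out| <= 1.
  apply/card_le1_eqP=> w w' wo wo'.
  have := wo; have := wo'; rewrite !in_set => /andP[cw' kw'] /andP[cw kw].
  (* Both orders of [w] and [w'] are needed: the last clause of [link_ok] lets its fourth argument
     replace the first class and its fifth the second. *)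
  have := allP (allP (allP (allP (allP link_check _ (class_kind cx)) _ (class_kind cy)) _
    (class_kind cz)) _ (class_kind cw)) _ (class_kind cw').
  have := allP (allP (allP (allP (allP link_check _ (class_kind cx)) _ (class_kind cy)) _
    (class_kind cz)) _ (class_kind cw')) _ (class_kind cw).
  rewrite /link_ok uk tri kw kw' !implyTb => /and3P[_ _ /implyP l'].
  move=> /and3P[/implyP l1 /implyP l2 /implyP l3].
  have mixed v v' : same v x -> same v' y -> v \in out -> v' \in out ->
      kind v != kind v' -> is_triad [:: kind v; kind v'; kind z].
    rewrite !in_set => vx vy /andP[cv kv] /andP[cv' kv'] kvv'.
    have := kv; rewrite !inE !negb_or => /and3P[kvx kvy kvz].
    have := kv'; rewrite !inE !negb_or => /and3P[kvx' kvy' kvz'].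
    have nv p := same_diff (z := p) vx; have nv' p := same_diff (z := p) vy.
    have nvv : ~~ same v v' by rewrite sameC nv' // sameC nv.
    have /andP[] // : (kind u \in [:: kind v; kind v'; kind z]) &&
      is_triad [:: kind v; kind v'; kind z].
    apply: four_labels; rewrite /= ?cv ?cv' ?cz ?cu //.
      by rewrite nvv !nv // !nv' // nzu.
    by rewrite !inE negb_or kvv' kvz kvz'.
  case: (outP w wo) (outP w' wo') => [[wx t1]|[wy t1]] [[wx' t2]|[wy' t2]].
  - apply: esym; apply: same_kind; last by apply/eqP/l1; rewrite t1.
    by apply: same_trans wx _; rewrite sameC.
  - have /andP[kk /negP[]] := l3 (introT andP (conj t1 t2)).
    exact: mixed.
  - have /andP[kk /negP[]] := l' (introT andP (conj t2 t1)).
    exact: mixed.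
  - apply: esym; apply: same_kind; last by apply/eqP/l2; rewrite t1.
    by apply: same_trans wy _; rewrite sameC.
have [k [m [kb mb pe]]] := triad_base tri.
apply: (good_of_rest kb); apply: leq_trans (omega_class3 mb).
rewrite (addnA _ 1 2) leq_add2r; apply: leq_trans (leq_add (leqnn _) out1).
apply: leq_trans (leq_card_setU _ _); apply/subset_leq_card/subsetP=> w.
rewrite in_setU !in_set (perm_mem pe) => /and3P[-> n1 n2].
by rewrite !inE (negPf n1) (negPf n2); case: eqP.
Qed.

(** At least four labels occur. The arguments may be cells, which share a label with no class
    vertex. *)
Definition many_labels :=
  forall x y z, exists u, [&& 8 < kind u, ~~ same x u, ~~ same y u & ~~ same z u].

Lemma good_of_rainbow x y z : many_labels ->
    all (fun w => 8 < kind w) [:: x; y; z] ->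
    pairwise (fun v w => ~~ same v w) [:: x; y; z] ->
  uniq [:: kind x; kind y; kind z] -> good (compl G).
Proof.
move=> many cl pw uk; have [u /and4P[cu nxu nyu nzu]] := many x y z.
have := cl; rewrite /= andbT => /and3P[cx cy cz].
have := pw; rewrite /= !andbT -!andbA => /and3P[nxy nxz nyz].
have := uk; rewrite /= !inE negb_or andbT -andbA => /and3P[kxy kxz kyz].
have cl4 : all (fun w => 8 < kind w) [:: x; y; z; u] by rewrite /= cx cy cz cu.
have pw4 : pairwise (fun v w => ~~ same v w) [:: x; y; z; u].
  by rewrite /= nxy nxz nxu nyz nyu nzu.
have /andP[] := four_labels cl4 pw4 uk; rewrite !inE => /or3P[]/eqP ku _.
- apply: (@good_of_two_in_triad y z x u) => //=; rewrite ?cx ?cy ?cz ?cu //.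
    by rewrite nyz nyu nzu nxu ![same _ x]sameC nxy nxz.
  by rewrite !inE negb_or kyz ![_ == kind x]eq_sym kxy kxz.
- apply: (@good_of_two_in_triad x z y u) => //=; rewrite ?cx ?cy ?cz ?cu //.
    by rewrite nxz nxy nxu nzu nyu [same z y]sameC nyz.
  by rewrite !inE negb_or kxy kxz [_ == kind y]eq_sym kyz.
- exact: (@good_of_two_in_triad x y z u).
Qed.

Lemma class_of_base c : c \in class_kinds ->
  exists2 k, k \in base_kinds & c \in [:: 9 + k %/ 3; 12 + k %% 3].
Proof.
have /allP h : all (fun c => has (fun k =>
  c \in [:: 9 + k %/ 3; 12 + k %% 3]) base_kinds) class_kinds by [].
by case/h/hasP=> k; exists k.
Qed.

(** A base vertex on the grid line of [c] sees all of [c], so its [rest] lies in [d]. *)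
Lemma good_of_two_classes c d : c \in class_kinds -> d \in class_kinds ->
  (forall w, 8 < kind w -> kind w \in [:: c; d]) -> good (compl G).
Proof.
move=> cc dd two; have [k kb kc] := class_of_base cc.
apply: (good_of_rest kb); apply: leq_trans (omega_class2 dd); rewrite leq_add2r.
apply/subset_leq_card/subsetP=> w; rewrite !inE => /and3P[/two].
rewrite !inE => /orP[/eqP->|//]; move: kc; rewrite !inE.
by case/orP=> /eqP<-; rewrite eqxx ?andbF.
Qed.

(** Outside [c] there is only one label, hence at most one vertex per class. A base vertex on the
    line of [c] then has at most four vertices in its [rest], so omega at least 6 suffices. *)
Lemma good_of_class_label c y (s : seq G) : uniq s -> size s = 3 ->
    {in s, forall x, (kind x == c) && ~~ same x y} -> c \in class_kinds ->
    (forall w, 8 < kind w -> kind w != c -> same w y) -> good (compl G).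
Proof.
move=> us s3 sc cc lab.
have card3 : 3 <= #|cls c|.
  rewrite -s3 -(card_uniqP us); apply/subset_leq_card/subsetP=> x /sc /andP[kx _].
  by rewrite inE.
have restc k r : c \in [:: 9 + k %/ 3; 12 + k %% 3] ->
    {in rest k, forall w, kind w \in r} -> #|rest k| <= size r.
  move=> kc; apply: card_le_kinds => w w'; rewrite !inE.
  have nc v : [&& 8 < kind v, kind v != 9 + k %/ 3 & kind v != 12 + k %% 3] -> same v y.
    case/and3P=> cv nv1 nv2; apply: lab => //; move: kc; rewrite !inE.
    by case/orP=> /eqP->.
  move=> /nc wy /nc wy'; apply: same_kind; apply: same_trans wy _.
  by rewrite sameC.
have six k : k \in base_kinds -> c \in [:: 9 + k %/ 3; 12 + k %% 3] ->
    6 <= omega (compl G) -> good (compl G).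
  move=> kb kc om6; apply: (good_of_rest kb).
  pose r := [seq l <- class_kinds | (l != 9 + k %/ 3) && (l != 12 + k %% 3)].
  have szr : size r = 4 by apply/eqP; rewrite /r; move: k kb {kc r}; apply/allP.
  apply: leq_trans om6; rewrite -[6]/(4 + 2) leq_add2r -szr; apply: restc => // w.
  by rewrite !inE mem_filter => /and3P[/class_kind-> -> ->].
have [k7|nk7] := boolP (c \in [:: 11; 13]); last first.
  have c4 : c \in [:: 9; 10; 12; 14].
    by move: cc nk7; rewrite !inE; do 6?[case: eqP => //= _].
  have [k kb kc] := class_of_base cc; apply: (six k) => //.
  by apply: leq_trans (omega_class3 c4); rewrite -[6]/(3 + 3) leq_add2r.
(* Cell 7, the vertex t, lies on both row 2 and column 1, so it serves both classes not covered by
   [omega_class3]. *)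
have six7 := six 7 isT k7.
(* If no class of [js] is occupied, t has at most two vertices in its [rest]. If some [w] there
   shares its label with a vertex of [c], then [c] has four vertices; otherwise [w] and the pair
   [ks] extend [c] to a stable set. The last two cases give omega at least 6. *)
have fin js ks : all (fun j => [&& 8 < j, j != c, ~~ madj j c false & fits j ks]) js ->
    8 < c -> fits c ks -> size ks = 2 ->
    size [seq j <- [:: 9; 10; 12; 14] | j \notin js] = 2 -> good (compl G).
  move=> /allP jsP c8 /fits_bv[uks k9 kk kc] sz2 sznj.
  have [/existsP[w kw]|/existsPn now] := boolP [exists w, kind w \in js]; last first.
    apply: (@good_of_rest 7) => //; apply: leq_trans (omega_class2 cc).
    rewrite leq_add2r; apply: leq_trans (ltnW card3); rewrite -[X in _ <= X]sznj.
    apply: restc => // w; rewrite in_set mem_filter now => /and3P[/class_kind].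
    by rewrite !inE; do 6!case: eqP => //= _.
  have /and4P[cw nwc mwc /fits_bv[_ _ _ kw']] := jsP _ kw.
  have [/existsP[x /andP[kx xw]]|/existsPn nox] :=
    boolP [exists x, (kind x == c) && same x w].
    apply: six7; apply: leq_trans (omega_class2 cc); rewrite -[6]/(4 + 2) leq_add2r.
    have ux : uniq (x :: s).
      rewrite /= us andbT; apply/negP=> /sc /andP[_ /negP[]].
      by apply: same_trans xw _; apply: lab.
    rewrite -[4]/3.+1 -s3 -[_.+1]/(size (x :: s)) -(card_uniqP ux).
    apply/subset_leq_card/subsetP=> v; rewrite !inE => /predU1P[->//|/sc /andP[]//].
  apply: six7; apply: leq_trans (_ : #|cls c| + size (w :: map bv ks) <= _).
    by rewrite /= size_map sz2 -[6]/(3 + 3) leq_add2r.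
  have w_bv : w \notin map bv ks by apply: contraL cw => /k9; rewrite -leqNgt.
  apply: omega_class => //=; first by rewrite w_bv.
  - move=> x; rewrite inE => /predU1P[->//|/k9 lt].
    by rewrite ltn_eqF // (leq_trans lt).
  - move=> x v; rewrite !inE => /predU1P[->|xk] /predU1P[->|vk].
    + by rewrite adj_irr.
    + by rewrite adj_sym kw'.
    + exact: kw'.
    + exact: kk.
  - move=> x v; rewrite inE => /predU1P[->|xk] kv; last exact: kc.
    by have := nox v; rewrite kv eqxx sameC /= => /adj_diff->; rewrite kv.
move: k7 fin; rewrite !inE => /orP[]/eqP-> fin.
  exact: (fin [:: 12; 14] [:: 4; 1]).
exact: (fin [:: 9; 10] [:: 8; 6]).
Qed.

Lemma good_of_many_labels : many_labels -> good (compl G).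
Proof.
move=> many.
have [/existsP[x /existsP[y /existsP[z /and3P[cl pw uk]]]]|norain] := boolP
  [exists x, exists y, exists z, [&& all (fun w => 8 < kind w) [:: x; y; z],
    pairwise (fun v w => ~~ same v w) [:: x; y; z] & uniq [:: kind x; kind y; kind z]]].
  exact: good_of_rainbow uk.
have {}norain x y z : 8 < kind x -> 8 < kind y -> 8 < kind z ->
    ~~ same x y -> ~~ same x z -> ~~ same y z ->
    kind x != kind y -> kind x != kind z -> kind y != kind z -> False.
  move=> cx cy cz nxy nxz nyz kxy kxz kyz; case/negP: norain.
  apply/existsP; exists x; apply/existsP; exists y; apply/existsP; exists z.
  by rewrite /= cx cy cz nxy nxz nyz !inE negb_or kxy kxz kyz.
have [/hasP[c cc /hasP[d dd /forallP two]]|not2] := boolP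
  (has (fun c => has (fun d =>
     [forall w, (8 < kind w) ==> (kind w \in [:: c; d])]) class_kinds) class_kinds).
  by apply: (good_of_two_classes cc dd) => w; apply/implyP.
have {}not2 c d : c \in class_kinds -> d \in class_kinds ->
    exists2 w, 8 < kind w & (kind w != c) && (kind w != d).
  move=> cc dd; move: not2 => /hasPn/(_ c cc)/hasPn/(_ d dd)/forallPn[w].
  by rewrite negb_imply !inE negb_or => /andP[cw kw]; exists w.
have nsame_r v w w' : same w v -> ~~ same w' v -> ~~ same w' w.
  by move=> wv; rewrite ![same w' _]sameC; apply: same_diff.
have [x [y [cx cy kxy nxy]]] : exists x y,
    [/\ 8 < kind x, 8 < kind y, kind x != kind y & ~~ same x y].
  (* Instantiated at a cell merely to obtain some class vertex. *)
  have [x0 /and4P[c0 _ _ _]] := many v1 v1 v1.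
  have [y0 c1 /andP[k1 _]] := not2 _ _ (class_kind c0) (class_kind c0).
  have [s01|n01] := boolP (same x0 y0); last first.
    by exists x0, y0; split=> //; rewrite eq_sym.
  have [u /and4P[cu nu _ _]] := many x0 x0 x0.
  have [ku|ku] := eqVneq (kind u) (kind x0).
    by exists y0, u; split=> //; [rewrite ku | apply: same_diff nu; rewrite sameC].
  by exists x0, u; split=> //; rewrite eq_sym.
have [z cz /andP[kzx kzy]] := not2 _ _ (class_kind cx) (class_kind cy).
(* Here [y'] and [z'] share a label in different classes. Without three class vertices differing in
   both class and label, every class vertex outside the class of [x'] must carry that label, while
   [u] and [v] bring two further labels into the class of [x']. *)
have core x' y' z' : 8 < kind x' -> 8 < kind y' -> 8 < kind z' ->
    kind x' != kind y' -> ~~ same x' y' -> kind z' != kind x' -> kind z' != kind y' ->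
    same z' y' -> good (compl G).
  move=> cx' cy' cz' kxy' nxy' kzx' kzy' zy'.
  have [u /and4P[cu nxu nyu _]] := many x' y' x'.
  have [v /and4P[cv nxv nyv nuv]] := many x' y' u.
  (* One of [y'] and [z'] differs in class from [w]; it completes [q] and [w] to an excluded
     triple. *)
  have outside q w : 8 < kind q -> 8 < kind w -> ~~ same q y' -> ~~ same q w ->
      ~~ same w y' -> kind q != kind y' -> kind q != kind z' -> kind w != kind q -> False.
    move=> cq cw nqy nqw nwy kqy kqz kwq.
    have nz p : ~~ same p y' -> ~~ same p z' by apply: nsame_r.
    have [kwy|kwy] := eqVneq (kind w) (kind y').
      by apply: (norain q w z'); rewrite ?nz // 1?[kind q == kind w]eq_sym // kwy eq_sym.
    by apply: (norain q w y') => //; rewrite eq_sym.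
  have kindx w : 8 < kind w -> ~~ same x' w -> ~~ same y' w -> kind w = kind x'.
    move=> cw nxw nyw; apply/eqP; apply: contraT => kwx.
    by case: (@outside x' w) => //; rewrite 1?sameC // eq_sym.
  apply: (@good_of_class_label (kind x') y' [:: x'; u; v]) => //.
  - by rewrite /= !inE !negb_or !diff_neq.
  - move=> w; rewrite !inE => /or3P[]/eqP->; rewrite ?eqxx ?nxy' //.
      by rewrite (kindx u) // eqxx sameC.
    by rewrite (kindx v) // eqxx sameC.
  - exact: class_kind.
  move=> w cw kw; apply: contraT => nwy.
  (* If [w] has the label of [x'], then [u], of the same class and another label, takes the place of
     [x']. *)
  have [xw|nxw] := boolP (same x' w).
    have ku := kindx u cu nxu nyu.
    case: (@outside u w) => //; rewrite ?ku // 1?eq_sym //.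
    - by rewrite sameC.
    - by rewrite sameC; apply: same_diff nxu; rewrite sameC.
  by case: (@outside x' w) => //; rewrite eq_sym.
have [zy|nzy] := boolP (same z y); first exact: (core x y z).
have [zx|nzx] := boolP (same z x).
  by apply: (core y x z) => //; rewrite 1?sameC // eq_sym.
by case: (norain x y z) => //; rewrite 1?sameC // eq_sym.
Qed.

(** * At most three labels *)

(** [code] embeds [G] as an induced subgraph of the 27-vertex graph with all base cells present, so
    the triangles and the stable set of the certificate pull back to [G]. *)
Lemma good_of_few_labels (lab : G -> nat) : (forall x, lab x < 3) ->
    (forall x y, 8 < kind x -> 8 < kind y -> same x y = (lab x == lab y)) ->
  good (compl G).
Proof.
move=> lab3 labE.
pose code x := if kind x < 9 then kind x else 9 + (6 * lab x + (kind x - 9)).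
have code9 x : 8 < kind x ->
    [/\ (code x < 9) = false, 9 + (code x - 9) %% 6 = kind x & (code x - 9) %/ 6 = lab x].
  move=> cx; have lt6 : kind x - 9 < 6 by rewrite ltn_subLR ?kind_lt.
  rewrite /code [kind x < 9]ltnNge cx /= addKn mulnC modnMDl modn_small // subnKC //.
  split=> //.
  by rewrite divnMDl // divn_small // addn0.
have kindE x : (if code x < 9 then code x else 9 + (code x - 9) %% 6) = kind x.
  case: (ltnP (kind x) 9) => kx; last by have [-> -> _] := code9 x kx.
  by rewrite /code kx kx.
have adj_code x y : adj x y = adj27 (code x) (code y).
  rewrite /adj27 !kindE adjE.
  case: (ltnP (kind x) 9) => kx; first exact: madj_special.
  case: (ltnP (kind y) 9) => ky.
    by rewrite ![madj (kind x) _ _]madjC; apply: madj_special.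
  by rewrite labE //; have [_ _ ->] := code9 x kx; have [_ _ ->] := code9 y ky.
have code_inj x y : code x = code y -> x = y.
  move=> cxy; have kxy : kind x = kind y by rewrite -kindE cxy kindE.
  case: (ltnP (kind x) 9) => kx; first exact: special_inj.
  have ky : 8 < kind y by rewrite -kxy.
  apply: same_kind => //; rewrite labE //.
  by have [_ _ <-] := code9 x kx; have [_ _ <-] := code9 y ky; rewrite cxy.
have code_lt x : code x < 27.
  rewrite /code; case: (ltnP (kind x) 9) => kx; first exact: leq_trans kx _.
  rewrite -[27]/(9 + (6 * 2 + 6)) ltn_add2l -addnS leq_add //.
    by rewrite leq_mul2l /= -ltnS.
  by rewrite ltn_subLR ?kind_lt.
pose P p := [exists x, code x == p].
have Pbase : all P base_kinds.
  apply/allP=> k kb; apply/existsP; exists (bv k); rewrite /code kind_bv //.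
  by move: k kb; apply/allP.
have [s [ts [us /allP Ps ss [szs tsc tsP]]]] := certifiesP schlaefli_certified Pbase isT.
pose cs : seq {set G} := [seq [set x | code x \in r] | r <- ts].
have le_s : size s <= #|[set x | code x \in s]|.
  rewrite cardE -(size_map code); apply: uniq_leq_size => // p ps.
  have /existsP[x /eqP xp] := Ps p ps.
  by apply/mapP; exists x; rewrite // mem_enum inE xp.
apply: (@good_of_cover _ cs [set x | code x \in s]).
- move=> c /mapP[r rts ->] x y; rewrite !inE => xr yr neq.
  rewrite adj_code; apply: (pairwise_clique (tsc r rts)) => //.
  by apply: contraNneq neq => /code_inj->.
- move=> x; rewrite has_map; have : P (code x) by apply/existsP; exists x.
  by move/(tsP _ (code_lt x)); apply: sub_has => r /=; rewrite inE.
- by apply/stableP=> x y; rewrite !inE adj_code; apply: ss.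
- by rewrite size_map (leq_trans szs) // leq_add2r.
Qed.

(** Labels are the equivalence classes of [same] on the class vertices; their number decides between
    the two preceding cases. *)
Lemma good_of_structure : good (compl G).
Proof.
pose K := [set x | 8 < kind x]; pose P := equivalence_partition same K.
have eqK : {in K & &, equivalence_rel same}.
  move=> x y z _ _ _; split=> [|xy]; first exact: samexx.
  by apply/idP/idP; apply: same_trans; rewrite // sameC.
have partP : partition P K by apply: equivalence_partitionP.
have [_ tI n0] := and3P partP.
have [le3|gt3] := leqP #|P| 3.
  pose lab x := if x \in K then index (pblock P x) (enum P) else 0.
  have memP x : x \in K -> pblock P x \in enum P.
    by move=> xK; rewrite mem_enum pblock_mem // (cover_partition partP).
  apply: (@good_of_few_labels lab) => [x|x y cx cy].
    rewrite /lab; case: ifP => // /memP xP; apply: leq_trans le3.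
    by rewrite cardE index_mem.
  have [xK yK] : x \in K /\ y \in K by rewrite !inE.
  rewrite /lab xK yK -(pblock_equivalence_partition eqK xK yK) -/P.
  apply/idP/eqP => [yx|/(congr1 (nth set0 (enum P)))].
    by rewrite (same_pblock tI yx).
  by rewrite !nth_index ?memP // => ->; rewrite mem_pblock (cover_partition partP).
apply: good_of_many_labels => x y z.
(* Three blocks cannot exhaust [P]; for a cell, [pblock] is the empty set and does no harm. *)
have : 0 < #|P :\: [set pblock P x; pblock P y; pblock P z]|.
  rewrite cardsD subn_gt0 (leq_ltn_trans _ gt3) //.
  rewrite (leq_trans (subset_leq_card (subsetIr _ _))) //.
  by rewrite (leq_trans (leq_card_setU _ _)) // cards1 addn1 ltnS cards2; case: (_ != _).
case/card_gt0P=> B; rewrite !inE !negb_or -!andbA => /and4P[Bx By Bz BP].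
have /set0Pn[u uB] : B != set0 by apply: contraNneq n0 => <-.
have uK : u \in K by rewrite -(cover_partition partP); apply/bigcupP; exists B.
exists u; have nsame w : B != pblock P w -> ~~ same w u.
  apply: contraNN => wu.
  have wK : w \in K by case/predU1P: wu => [->//|/and4P[kw _ _ _]]; rewrite inE.
  move: wu; rewrite -(pblock_equivalence_partition eqK wK uK) -/P => wu.
  by rewrite -(same_pblock tI wu) (def_pblock tI BP uB).
by move: uK; rewrite inE => ->; rewrite !nsame.
Qed.

End Kinds.

End Structure.

Theorem theorem3p5 (G : sgraph)
  (hP2P3 : ~ contains_induced G P2_P3)
  (hcoP2P3 : ~ contains_induced G (compl P2_P3))
  (hK2K3 : ~ contains_induced G K2_K3)
  (hcobanner : ~ contains_induced G co_banner)
  (hcoH2 : ~ contains_induced G co_H2)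
  (hcoH3 : contains_induced G co_H3) :
  good (compl G).
Proof.
have [f [fI fA]] := hcoH3.
have free (vs : seq G) : uniq vs -> ~~ bad (amx vs) by apply: amx_free.
(* co_H3 is given as the complement of H3: there 4, 5, 0, 2 form the 4-cycle and
   3, 1 are b, t. *)
pose s : seq 'I_6 := [:: @Ordinal 6 4 isT; @Ordinal 6 5 isT; @Ordinal 6 0 isT;
                         @Ordinal 6 2 isT; @Ordinal 6 3 isT; @Ordinal 6 1 isT].
have us : uniq (map f s) by rewrite (map_inj_uniq fI).
have amxs : amx (map f s) = base_mx.
  by rewrite /amx /= !fA.
apply: (good_of_kinds free us amxs) => kind lt15 sigE.
exact: good_of_structure sigE.
Qed.
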